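(* For every $f\in L^1(\mathbb S^2)$, the vertical slice transforms of measures and of functions satisfy $$\mathcal V[f\sigma_{\mathbb S^2}]=(\mathcal Vf)\,\sigma_{\mathbb T\times\mathbb I}\qquad\text{and}\qquad\mathcal V_\psi[f\sigma_{\mathbb S^2}]=(\mathcal V_\psi f)\,\sigma_{\mathbb I}\quad(\psi\in\mathbb T).$$ In particular, the transformed measures are again absolutely continuous.
   Context: $\mathbb S^2\subset\mathbb R^3$ is the unit sphere with surface measure $\sigma_{\mathbb S^2}$, $\mathbb I=[-1,1]$, $\mathbb T=\mathbb R/(2\pi\mathbb Z)$; $\sigma_{\mathbb I}$ and $\sigma_{\mathbb T\times\mathbb I}$ are Lebesgue measures ($\mathbb T$ has total mass $2\pi$), and $u_{\mathbb T}=(2\pi)^{-1}\sigma_{\mathbb T}$ is the uniform probability measure. $\mathcal M(X)$ denotes finite signed Borel measures on $X$; $h\sigma$ is the measure with density $h$ w.r.t. $\sigma$; $T_\#\mu=\mu\circ T^{-1}$. For $\psi\in\mathbb T$ let $\mathcal S_\psi\colon\mathbb S^2\to\mathbb I$, $\mathcal S_\psi(\xi)=\xi_1\cos\psi+\xi_2\sin\psi$, and $C_\psi^t=\mathcal S_\psi^{-1}(t)$. Transforms of functions: $\mathcal Vf(\psi,t)=\frac1{2\pi\sqrt{1-t^2}}\int_{C_\psi^t}f(\xi)\,ds(\xi)$ for $\psi\in\mathbb T$, $t\in(-1,1)$ ($ds$ arc length), $\mathcal Vf(\psi,\pm1)=f(\pm\cos\psi,\pm\sin\psi,0)$, and $\mathcal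 V_\psi f=2\pi\,\mathcal Vf(\psi,\cdot)$; for $f\in L^1(\mathbb S^2)$ these are defined almost everywhere. Transforms of measures: for $\mu\in\mathcal M(\mathbb S^2)$, $\mathcal V_\psi\mu=(\mathcal S_\psi)_\#\mu\in\mathcal M(\mathbb I)$ and $\mathcal V\mu=(T_{\mathcal V})_\#(u_{\mathbb T}\times\mu)\in\mathcal M(\mathbb T\times\mathbb I)$ with $T_{\mathcal V}(\psi,\xi)=(\psi,\mathcal S_\psi(\xi))$. *)

(* Defs.v *)
From HB Require Import structures.
From mathcomp Require Import all_boot all_order all_algebra.
From mathcomp Require Import generic_quotient.
From mathcomp Require Import all_classical all_reals all_analysis.
From mathcomp Require Import measurable_realfun ring lra.

Set Implicit Arguments.
Unset Strict Implicit.
Unset Printing Implicit Defensive.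

Import Order.TTheory GRing.Theory Num.Theory.
Import numFieldNormedType.Exports.

Local Open Scope quotient_scope.
Local Open Scope classical_set_scope.
Local Open Scope ring_scope.

Definition borel (X : ptopologicalType) : measurableType (@open X).-sigma :=
  g_sigma_algebraType (@open X).

Section borel_measurability.

Lemma measurable_fun_borel d (T : measurableType d) (Y : ptopologicalType)
    (f : T -> borel Y) :
  (forall U : set Y, open U -> measurable (f @^-1` U)) ->
  measurable_fun [set: T] f.
Proof.
move=> h; apply: (@measurability _ _ T (borel Y) setT f (@open Y)) => //.
by move=> _ [U oU <-]; rewrite setTI; exact: h.
Qed.

Lemma continuous_borel_measurable (X : ptopologicalType) (R : realType)
    (f : borel X -> R) :
  continuous (f : X -> R) -> measurable_fun [set: borel X] f.
Proof.
move=> /continuousP cf.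
apply: (@measurability _ _ (borel X) R setT f (@RGenOpens.G R)).
  exact: RGenOpens.measurableE.
move=> _ [_ [x [y ->]] <-]; rewrite setTI.
by apply: sub_sigma_algebra; apply: cf; exact: interval_open.
Qed.

Lemma open_mx_measurable (R : realType) n d (T : measurableType d)
    (g : T -> 'rV[R]_n) :
  (forall i, measurable_fun [set: T] (fun x => g x 0 i)) ->
  forall U : set 'rV[R]_n, open U -> measurable (g @^-1` U).
Proof.
move=> mg U oU.
pose B (p : 'rV[rat]_n * 'rV[rat]_n) : set 'rV[R]_n :=
  [set x | forall i, x 0 i \in `]ratr (p.1 0 i), ratr (p.2 0 i)[].
have mB p : measurable (g @^-1` B p).
  have -> : g @^-1` B p =
    \bigcap_(i in [set: 'I_n])
      ((fun x => g x 0 i) @^-1` `]ratr (p.1 0 i), ratr (p.2 0 i)[%classic).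
    apply/seteqP; split => [x Bx i _|x Bx i]; first exact: Bx.
    exact: Bx.
  apply: fin_bigcap_measurable; first exact: finite_finset.
  by move=> i _; rewrite -[X in measurable X]setTI; exact: mg.
have -> : U = \bigcup_(p in [set p | B p `<=` U]) B p.
  apply/seteqP; split => [x Ux|x [p pU]]; last exact: pU.
  have /nbhs_ballP[e /= e0 eU] : nbhs x U by exact: open_nbhs_nbhs.
  have lo i : exists q : rat, ratr q \in `]x 0 i - e, x 0 i[.
    by apply: rat_in_itvoo; rewrite ltrBlDr ltrDl.
  have hi i : exists q : rat, ratr q \in `]x 0 i, x 0 i + e[.
    by apply: rat_in_itvoo; rewrite ltrDl.
  have [l lP] := choice lo; have [u uP] := choice hi.
  exists (\row_i l i, \row_i u i) => /=.
    move=> y By; apply: eU; split => // i j; rewrite !ord1 {i}.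
    have := By j; have := lP j; have := uP j; rewrite /= !mxE !in_itv/=.
    move=> /andP[u1 u2] /andP[l1 l2] /andP[y1 y2].
    by rewrite -ball_normE/= ltr_distl; apply/andP; split; lra.
  move=> i; have := lP i; have := uP i; rewrite /= !mxE !in_itv/=.
  by move=> /andP[u1 u2] /andP[l1 l2]; rewrite l2 u1.
rewrite preimage_bigcup bigcup_mkcond.
by apply: countable_bigcupT_measurable => // p; case: ifP.
Qed.

End borel_measurability.

Section torus.
Variable R : realType.

Definition torus_rel (x y : R) : bool := (x - y) / (2 * pi) \is a Num.int.

Lemma torus_rel_refl : reflexive torus_rel.
Proof. by move=> x; rewrite /torus_rel subrr mul0r rpred0. Qed.

Lemma torus_rel_sym : symmetric torus_rel.
Proof. by move=> x y; rewrite /torus_rel -opprB mulNr rpredN. Qed.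

Lemma torus_rel_trans : transitive torus_rel.
Proof.
by move=> y x z xy yz; rewrite /torus_rel -(subrKA y) mulrDl rpredD.
Qed.

Definition torus_equiv :=
  EquivRel torus_rel torus_rel_refl torus_rel_sym torus_rel_trans.

Definition torus_space : ptopologicalType :=
  quotient_topology {eq_quot torus_equiv}.

(* R / 2 pi Z with the Borel sets of the quotient topology *)
Definition torus := borel torus_space.

Definition torus_pi (x : R) : torus := \pi_(torus_space) x.

Lemma measurable_torus_pi : measurable_fun [set: R] torus_pi.
Proof. by apply: measurable_fun_borel => U oU; exact: open_measurable. Qed.

Definition torus_measure : set torus -> \bar R :=
  pushforward (mrestr (@lebesgue_measure R) (measurable_itv `[0, 2 * pi[))
    torus_pi.


Let torus_measure0 : torus_measure set0 = 0%E.
Proof. by apply: measure0; exact: measurable_torus_pi. Qed.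

Let torus_measure_ge0 A : (0 <= torus_measure A)%E.
Proof. by apply: measure_ge0; exact: measurable_torus_pi. Qed.

Let torus_measure_sigma_additive : semi_sigma_additive torus_measure.
Proof. by apply: measure_semi_sigma_additive; exact: measurable_torus_pi. Qed.

HB.instance Definition _ := isMeasure.Build _ _ _ torus_measure
  torus_measure0 torus_measure_ge0 torus_measure_sigma_additive.

Lemma torus_measureT : torus_measure [set: torus] = (2 * pi)%:E.
Proof.
rewrite /torus_measure /pushforward/= preimage_setT /mrestr setTI.
by rewrite lebesgue_measure_itv/= lte_fin mulr_gt0 ?pi_gt0// oppr0 adde0.
Qed.

Let torus_measure_fin : fin_num_fun torus_measure.
Proof.
move=> A mA; rewrite ge0_fin_numE//.
apply: (@le_lt_trans _ _ (torus_measure setT)); last first.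
  by rewrite torus_measureT ltry.
by apply: le_measure; rewrite ?inE.
Qed.

HB.instance Definition _ := @Measure_isFinite.Build _ _ _
  torus_measure torus_measure_fin.

Let twopiV_ge0 : 0 <= (2 * pi : R)^-1.
Proof. by rewrite invr_ge0 mulr_ge0 ?pi_ge0. Qed.

Definition torus_unif : set torus -> \bar R :=
  mscale (NngNum twopiV_ge0) torus_measure.

HB.instance Definition _ := Measure.on torus_unif.

Let torus_unifT : torus_unif [set: torus] = 1%E.
Proof.
rewrite /torus_unif /mscale/= torus_measureT -EFinM mulVf//.
by rewrite gt_eqF// mulr_gt0 ?pi_gt0.
Qed.

HB.instance Definition _ := Measure_isProbability.Build _ _ _
  torus_unif torus_unifT.

Definition torus_cos (psi : torus) : R := cos (repr (psi : torus_space)).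
Definition torus_sin (psi : torus) : R := sin (repr (psi : torus_space)).

Lemma torus_pi_homo (g : R -> R) : periodic g (pi *+ 2) ->
  {homo g : a b / \pi_torus_space a == \pi_torus_space b >-> a == b}.
Proof.
move=> gp a b /eqP ab.
have /eqmodP/intrP[n nE] : a = b %[mod_eq torus_equiv] by [].
have pi2 : 2 * pi != 0 :> R by rewrite mulf_neq0// gt_eqF// pi_gt0.
have -> : a = b + (pi *+ 2) *~ n.
  apply/eqP; rewrite addrC -subr_eq; apply/eqP.
  by rewrite -(mulfVK pi2 (a - b)) nE mulrzl mulr_natl.
case: n nE => n _; first by rewrite -pmulrn (periodicn gp).
rewrite NegzE mulrNz -pmulrn.
by rewrite -[in eqbRHS](subrK (pi *+ 2 *+ n.+1) b) (periodicn gp).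
Qed.

(* [torus_cos] and [torus_sin] do not depend on the choice of [repr]. *)
Lemma torus_cosE x : torus_cos (torus_pi x) = cos x.
Proof.
by apply/eqP; apply: (torus_pi_homo (@cosD2pi R)); rewrite reprK.
Qed.

Lemma torus_sinE x : torus_sin (torus_pi x) = sin x.
Proof.
by apply/eqP; apply: (torus_pi_homo (@sinD2pi R)); rewrite reprK.
Qed.

Lemma measurable_torus_cos : measurable_fun [set: torus] torus_cos.
Proof.
apply: continuous_borel_measurable.
apply: (@repr_comp_continuous R {eq_quot torus_equiv}); first exact: continuous_cos.
exact: (torus_pi_homo (@cosD2pi R)).
Qed.

Lemma measurable_torus_sin : measurable_fun [set: torus] torus_sin.
Proof.
apply: continuous_borel_measurable.
apply: (@repr_comp_continuous R {eq_quot torus_equiv}); first exact: continuous_sin.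
exact: (torus_pi_homo (@sinD2pi R)).
Qed.

End torus.

Arguments torus_measure : clear implicits.
Arguments torus_unif : clear implicits.

Section sphere_interval.
Variable R : realType.

Definition unit_sphere : set 'rV[R]_3 := [set x | \sum_(i < 3) x 0 i ^+ 2 = 1].

Definition vec3 (a b c : R) : 'rV[R]_3 := \row_i nth 0 [:: a; b; c] i.

Lemma vec3_unit_sphere a b c :
  a ^+ 2 + b ^+ 2 + c ^+ 2 = 1 -> vec3 a b c \in unit_sphere.
Proof.
move=> abc; rewrite inE /unit_sphere/= !big_ord_recl big_ord0 !mxE/= addr0.
by rewrite addrA.
Qed.

Definition S2_space : Type := set_type unit_sphere.

HB.instance Definition _ := Topological.copy S2_space (set_type unit_sphere).

Definition S2_pt a b c (abc : a ^+ 2 + b ^+ 2 + c ^+ 2 = 1) : S2_space :=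
  exist _ (vec3 a b c) (vec3_unit_sphere abc).

Lemma north_pole_subproof : (0 : R) ^+ 2 + 0 ^+ 2 + 1 ^+ 2 = 1.
Proof. by rewrite !expr0n/= !add0r expr1n. Qed.

HB.instance Definition _ := isPointed.Build S2_space (S2_pt north_pole_subproof).

Definition S2 := borel S2_space.

(* xi_1, xi_2, xi_3 are [crd 0], [crd 1], [crd 2] *)
Definition crd (i : 'I_3) (x : S2) : R := (\val x : 'rV[R]_3) 0 i.

Definition Ibd_space : Type := set_type (`[-1, 1]%classic : set R).

HB.instance Definition _ :=
  Topological.copy Ibd_space (set_type (`[-1, 1]%classic : set R)).

Lemma Ibd_subproof (t : R) : -1 <= t <= 1 -> t \in (`[-1, 1]%classic : set R).
Proof. by move=> t1; rewrite inE/= in_itv. Qed.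

Lemma Ibd_point_subproof : -1 <= (0 : R) <= 1.
Proof. by rewrite lerN10 ler01. Qed.

Definition Ibd_pt (t : R) (t1 : -1 <= t <= 1) : Ibd_space :=
  exist _ t (Ibd_subproof t1).

HB.instance Definition _ := isPointed.Build Ibd_space (Ibd_pt Ibd_point_subproof).

Definition Ibd := borel Ibd_space.

Definition Ival (t : Ibd) : R := \val t.

Lemma continuous_crd i : continuous (crd i : S2_space -> R).
Proof.
move=> x; apply: (@continuous_comp _ _ _ (@set_val _ unit_sphere) (fun y => y 0 i)).
  exact: initial_continuous.
exact: coord_continuous.
Qed.

Lemma measurable_crd i : measurable_fun [set: S2] (crd i).
Proof. by apply: continuous_borel_measurable; exact: continuous_crd. Qed.

Lemma measurable_Ival : measurable_fun [set: Ibd] Ival.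
Proof. by apply: continuous_borel_measurable; exact: initial_continuous. Qed.

Lemma measurable_fun_S2 d (T : measurableType d) (g : T -> S2) :
  (forall i, measurable_fun [set: T] (crd i \o g)) -> measurable_fun [set: T] g.
Proof.
move=> mg; apply: measurable_fun_borel => _ [V oV <-].
exact: (@open_mx_measurable R 3 _ T (fun x => \val (g x) : 'rV[R]_3)).
Qed.

Lemma measurable_fun_Ibd d (T : measurableType d) (g : T -> Ibd) :
  measurable_fun [set: T] (Ival \o g) -> measurable_fun [set: T] g.
Proof.
move=> mg; apply: measurable_fun_borel => _ [V oV <-].
rewrite -[X in measurable X]setTI; apply: mg => //; exact: open_measurable.
Qed.

Lemma measurable_Ival_image (A : set Ibd) :
  measurable A -> measurable (Ival @` A).
Proof.
have -> : (measurable : set (set Ibd)) =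
    preimage_set_system setT Ival (measurable : set (set R)).
  have -> : (measurable : set (set R)) = <<s @open R >>.
    apply/seteqP; split => [B|].
      rewrite [X in X B -> _](RGenOpens.measurableE R).
      apply: smallest_sub; first exact: smallest_sigma_algebra.
      move=> _ [x [y ->]]; apply: sub_sigma_algebra; exact: interval_open.
    apply: smallest_sub; first exact: sigma_algebra_measurable.
    by move=> B; exact: open_measurable.
  rewrite -g_sigma_preimageE; congr (<<s _ >>).
  apply/seteqP; split => [_ [V oV <-]|_ [V oV <-]]; first by exists V; rewrite ?setTI.
  by exists V => //; rewrite setTI.
move=> [B mB <-]; rewrite setTI.
have -> : Ival @` (Ival @^-1` B) = B `&` `[-1, 1]%classic.
  apply/seteqP; split => [_ [t Bt <-]|t [Bt t1]].
    by split => //; exact: set_valP.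
  by exists (exist _ t (mem_set t1)).
exact: measurableI.
Qed.

Definition Ibd_measure (A : set Ibd) : \bar R := lebesgue_measure (Ival @` A).

Lemma Ival_inj : injective Ival.
Proof. exact: val_inj. Qed.

Let Ibd_measure0 : Ibd_measure set0 = 0%E.
Proof. by rewrite /Ibd_measure image_set0 measure0. Qed.

Let Ibd_measure_ge0 A : (0 <= Ibd_measure A)%E.
Proof. exact: measure_ge0. Qed.

Let Ibd_measure_sigma_additive : semi_sigma_additive Ibd_measure.
Proof.
move=> F mF tF mUF; rewrite /Ibd_measure image_bigcup.
apply: measure_semi_sigma_additive.
- by move=> n; exact: measurable_Ival_image.
- apply/trivIsetP => i j _ _ ij; rewrite -subset0.
  move=> _ [[x Fx <-] [y Fy /Ival_inj yx]]; rewrite yx in Fy.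
  have : (F i `&` F j) x by [].
  by move/trivIsetP : tF => /(_ _ _ I I ij) ->.
- by rewrite -image_bigcup; exact: measurable_Ival_image.
Qed.

HB.instance Definition _ := isMeasure.Build _ _ _ Ibd_measure
  Ibd_measure0 Ibd_measure_ge0 Ibd_measure_sigma_additive.

Let Ibd_measure_fin : fin_num_fun Ibd_measure.
Proof.
move=> A mA; rewrite ge0_fin_numE//.
apply: (@le_lt_trans _ _ (lebesgue_measure (`[-1, 1]%classic : set R))).
  apply: le_measure; rewrite ?inE//; first exact: measurable_Ival_image.
  by move=> _ [t _ <-]; exact: set_valP.
by rewrite lebesgue_measure_itv/=; case: ifPn; rewrite ?ltry.
Qed.

HB.instance Definition _ := @Measure_isFinite.Build _ _ _
  Ibd_measure Ibd_measure_fin.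

End sphere_interval.

Arguments Ibd_measure : clear implicits.

Section product_charge.
Context d1 d2 (T1 : measurableType d1) (T2 : measurableType d2) (R : realType).
Variables (u : {finite_measure set T1 -> \bar R})
          (mu : {charge set T2 -> \bar R}).

(* [u \x mu] with a signed second factor; same formula as [product_measure1] *)
Definition product_charge (A : set (T1 * T2)) : \bar R :=
  (\int[u]_x mu (xsection A x))%E.

Let xsec_integrable (m : {finite_measure set T2 -> \bar R})
    (A : set (T1 * T2)) : measurable A ->
  u.-integrable [set: T1] (fun x => m (xsection A x)).
Proof.
move=> mA; apply/integrableP; split; first exact: measurable_fun_xsection.
apply: (@le_lt_trans _ _ (\int[u]_x m [set: T2])%E).
  apply: ge0_le_integral => //.
  - by apply: measurableT_comp => //; exact: measurable_fun_xsection.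
  - move=> x _; rewrite gee0_abs//; apply: le_measure; rewrite ?inE//.
    exact: measurable_xsection.
by rewrite integral_cst// ltey_eq fin_numM// fin_num_measure.
Qed.

Let product_chargeE P N (PN : hahn_decomposition mu P N) A : measurable A ->
  product_charge A = ((u \x jordan_pos PN) A - (u \x jordan_neg PN) A)%E.
Proof.
move=> mA; rewrite /product_charge -integralB//.
- apply: eq_integral => x _; rewrite (jordan_decomp PN); last first.
    exact: measurable_xsection.
  by rewrite /cadd/= cscaleN1.
- exact: xsec_integrable.
- exact: xsec_integrable.
Qed.

Let prod_fin (m : {finite_measure set T2 -> \bar R}) A : measurable A ->
  (u \x m)%E A \is a fin_num.
Proof.
by move=> mA; apply: integrable_fin_num => //; exact: xsec_integrable.
Qed.

Let product_charge0 : product_charge set0 = 0%E.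
Proof.
by apply: integral0_eq => x _; rewrite xsection0 charge0.
Qed.

Let product_charge_fin A : measurable A -> product_charge A \is a fin_num.
Proof.
have [P [N PN]] := Hahn_decomposition mu.
by move=> mA; rewrite (product_chargeE PN mA) fin_numB !prod_fin.
Qed.

Let product_charge_sigma_additive : semi_sigma_additive product_charge.
Proof.
have [P [N PN]] := Hahn_decomposition mu.
move=> F mF tF mUF; rewrite (product_chargeE PN mUF).
rewrite (_ : (fun _ => _) = fun n =>
    ((\sum_(0 <= i < n) (u \x jordan_pos PN) (F i)) -
     (\sum_(0 <= i < n) (u \x jordan_neg PN) (F i)))%E); last first.
  apply/funext => n; rewrite -sumeN; last first.
    by move=> i j _ _; rewrite fin_num_adde_defl// prod_fin.
  by rewrite -big_split/=; apply: eq_bigr => i _; exact: product_chargeE.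
apply: cvgeB.
- by rewrite fin_num_adde_defr// prod_fin.
- exact: measure_semi_sigma_additive.
- exact: measure_semi_sigma_additive.
Qed.

HB.instance Definition _ := isCharge.Build _ _ _ product_charge
  product_charge0 product_charge_fin product_charge_sigma_additive.

Lemma product_chargeX A B : measurable A -> measurable B ->
  product_charge (A `*` B) = (u A * mu B)%E.
Proof.
move=> mA mB; rewrite /product_charge.
rewrite (eq_integral (fun x => (\1_A x)%:E * mu B)%E); last first.
  move=> x _; rewrite indicE; have [xA|xA] /= := boolP (x \in A).
    by rewrite in_xsectionX// mul1e.
  by rewrite mul0e notin_xsectionX// charge0.
have /fineK <- : mu B \is a fin_num by exact: fin_num_measure.
rewrite integralZr//; first by rewrite integral_indic ?setIT.
exact: integrable_indic.
Qed.

End product_charge.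

Section pushforward_charge.
Context d1 d2 (T1 : measurableType d1) (T2 : measurableType d2) (R : realType).

Definition pushforward_charge (f : T1 -> T2) (mf : measurable_fun [set: T1] f)
    (mu : {charge set T1 -> \bar R}) : {charge set T2 -> \bar R}.
Proof.
refine (pushforward mu f : {charge set T2 -> \bar R}).
exact: mf.
Defined.

End pushforward_charge.
Section surface.
Variable R : realType.
Local Notation mu := (@lebesgue_measure R).

Definition dotp (u v : 'rV[R]_3) : R := \sum_i u 0 i * v 0 i.

Definition vderive1 (g : R -> 'rV[R]_3) (s : R) : 'rV[R]_3 :=
  \row_i derive1 (fun r => g r 0 i) s.

(* square root of the Gram determinant of the partial derivatives, that is the
   norm of their cross product *)
Definition area_element (g : R -> R -> 'rV[R]_3) (s t : R) : R :=
  let a := vderive1 (g ^~ t) s in let b := vderive1 (g s) t in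
  Num.sqrt (dotp a a * dotp b b - dotp a b ^+ 2).

Lemma sph_subproof (phi theta : R) :
  (cos phi * sin theta) ^+ 2 + (sin phi * sin theta) ^+ 2 + cos theta ^+ 2 = 1.
Proof. by rewrite !exprMn -mulrDl cos2Dsin2 mul1r addrC cos2Dsin2. Qed.

Definition sph (phi theta : R) : S2 R := S2_pt (sph_subproof phi theta).

Lemma area_element_sph (phi theta : R) :
  area_element (fun phi theta => \val (sph phi theta)) phi theta = `|sin theta|.
Proof.
rewrite /area_element.
have -> : vderive1 (fun phi => \val (sph phi theta)) phi =
    vec3 (- sin phi * sin theta) (cos phi * sin theta) 0.
  apply/rowP => i; rewrite !mxE derive1E.
  case: i => -[|[|[|//]]] i /=.
  - rewrite (_ : (fun _ => _) = (fun r => cos r * sin theta)); last first.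
      by apply/funext => r; rewrite mxE.
    by rewrite derive_val /GRing.scale/= mulr0 add0r mulrC.
  - rewrite (_ : (fun _ => _) = (fun r => sin r * sin theta)); last first.
      by apply/funext => r; rewrite mxE.
    by rewrite derive_val /GRing.scale/= mulr0 add0r mulrC.
  - rewrite (_ : (fun _ => _) = cst (cos theta)); last first.
      by apply/funext => r; rewrite mxE.
    by rewrite derive_val.
have -> : vderive1 (fun theta => \val (sph phi theta)) theta =
    vec3 (cos phi * cos theta) (sin phi * cos theta) (- sin theta).
  apply/rowP => i; rewrite !mxE derive1E.
  case: i => -[|[|[|//]]] i /=.
  - rewrite (_ : (fun _ => _) = (fun r => cos phi * sin r)); last first.
      by apply/funext => r; rewrite mxE.
    by rewrite derive_val.
  - rewrite (_ : (fun _ => _) = (fun r => sin phi * sin r)); last first.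
      by apply/funext => r; rewrite mxE.
    by rewrite derive_val.
  - rewrite (_ : (fun _ => _) = cos); last first.
      by apply/funext => r; rewrite mxE.
    by rewrite derive_val.
rewrite /dotp !big_ord_recl !big_ord0 !mxE/= -sqrtr_sqr; congr Num.sqrt.
have := cos2Dsin2 phi; have := cos2Dsin2 theta.
set c := cos phi; set s := sin phi; set C := cos theta; set S := sin theta.
move=> h1 h2.
transitivity (S ^+ 2 * (c ^+ 2 + s ^+ 2) *
              (C ^+ 2 * (c ^+ 2 + s ^+ 2) + S ^+ 2)); first by ring.
by rewrite h2 !mulr1 h1 mulr1.
Qed.

(* Surface measure of the parametrization [sph] by longitude and colatitude;
   [area_element_sph] shows that its density is the usual sin theta. *)
Definition sph_dom : set (R * R) := `[0, 2 * pi] `*` `[0, pi].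

Definition S2_measure (A : set (S2 R)) : \bar R :=
  (\int[mu \x mu]_(p in sph_dom `&` [set p | A (sph p.1 p.2)])
     (area_element (fun phi theta => \val (sph phi theta)) p.1 p.2)%:E)%E.

Lemma measurable_sph : measurable_fun [set: R * R] (fun p => sph p.1 p.2).
Proof.
have mc : measurable_fun [set: R] (@cos R).
  by apply: continuous_measurable_fun; exact: continuous_cos.
have ms : measurable_fun [set: R] (@sin R).
  by apply: continuous_measurable_fun; exact: continuous_sin.
apply: measurable_fun_S2 => -[[|[|[|//]]] i]; rewrite /comp /crd /=.
- under eq_fun do rewrite mxE/=.
  by apply: measurable_funM; apply: measurableT_comp.
- under eq_fun do rewrite mxE/=.
  by apply: measurable_funM; apply: measurableT_comp.
- under eq_fun do rewrite mxE/=.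
  by apply: measurableT_comp.
Qed.

Let measurable_sph_preimage (A : set (S2 R)) : measurable A ->
  measurable (sph_dom `&` [set p | A (sph p.1 p.2)]).
Proof.
move=> mA; apply: measurableI; first exact: measurableX.
by rewrite -[X in measurable X]setTI; exact: measurable_sph.
Qed.

Let measurable_area : measurable_fun [set: R * R] (fun p =>
  (area_element (fun phi theta => \val (sph phi theta)) p.1 p.2)%:E).
Proof.
apply/measurable_EFinP; under eq_fun do rewrite area_element_sph.
apply: measurableT_comp => //; apply: measurableT_comp => //.
by apply: continuous_measurable_fun; exact: continuous_sin.
Qed.

Let S2_measure0 : S2_measure set0 = 0%E.
Proof.
rewrite /S2_measure (_ : _ `&` _ = set0) ?integral_set0//.
by apply/seteqP; split => // p [].
Qed.

Let S2_measure_ge0 A : (0 <= S2_measure A)%E.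
Proof. by apply: integral_ge0 => p _; rewrite lee_fin sqrtr_ge0. Qed.

Let S2_measure_sigma_additive : semi_sigma_additive S2_measure.
Proof.
move=> F mF tF mUF; rewrite /S2_measure.
rewrite (_ : _ `&` _ =
    \bigcup_n (sph_dom `&` [set p | F n (sph p.1 p.2)])); last first.
  by rewrite -setI_bigcupr; congr (_ `&` _).
apply: (semi_sigma_additive_nng_induced (mu := (mu \x mu)%E)) => //.
- by move=> p; rewrite lee_fin sqrtr_ge0.
- by move=> n; exact: measurable_sph_preimage.
- apply/trivIsetP => i j _ _ ij; rewrite -subset0 => p [[_ Fi] [_ Fj]].
  have : (F i `&` F j) (sph p.1 p.2) by [].
  by move/trivIsetP : tF => /(_ _ _ I I ij) ->.
- by apply: bigcup_measurable => n _; exact: measurable_sph_preimage.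
Qed.

HB.instance Definition _ := isMeasure.Build _ _ _ S2_measure
  S2_measure0 S2_measure_ge0 S2_measure_sigma_additive.

End surface.

Arguments S2_measure : clear implicits.

Section transforms.
Variable R : realType.

Lemma slice_subproof (psi : torus R) (x : S2 R) :
  -1 <= crd 0 x * torus_cos psi + crd 1 x * torus_sin psi <= 1.
Proof.
have := cos2Dsin2 (repr (psi : torus_space R)).
have : crd 0 x ^+ 2 + crd 1 x ^+ 2 <= 1.
  have <- : \sum_(i < 3) crd i x ^+ 2 = 1 by exact: set_valP x.
  rewrite !big_ord_recl big_ord0 addr0 addrA.
  rewrite (_ : lift ord0 ord0 = 1); last exact: val_inj.
  by rewrite lerDl sqr_ge0.
rewrite /torus_cos /torus_sin; set c := cos _; set s := sin _.
set a := crd _ _; set b := crd _ _ => ab cs.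
rewrite -ler_norml -(@ler_pXn2r _ 2)// ?nnegrE// real_normK ?num_real// expr1n.
have -> : (a * c + b * s) ^+ 2 =
  (a ^+ 2 + b ^+ 2) * (c ^+ 2 + s ^+ 2) - (a * s - b * c) ^+ 2 by ring.
by rewrite cs mulr1 (le_trans _ ab)// gerBl sqr_ge0.
Qed.

Definition slice (psi : torus R) (x : S2 R) : Ibd R :=
  Ibd_pt (slice_subproof psi x).

Lemma measurable_slice psi : measurable_fun [set: S2 R] (slice psi).
Proof.
apply: measurable_fun_Ibd; rewrite /comp /Ival/=.
by apply: measurable_funD; apply: measurable_funM => //; exact: measurable_crd.
Qed.

Definition T_V (p : torus R * S2 R) : torus R * Ibd R := (p.1, slice p.1 p.2).

Lemma measurable_T_V : measurable_fun [set: torus R * S2 R] T_V.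
Proof.
apply: measurable_fun_pair => //; apply: measurable_fun_Ibd.
rewrite /comp /Ival/=.
apply: measurable_funD; apply: measurable_funM.
- exact: (measurableT_comp (measurable_crd 0)).
- exact: (measurableT_comp (@measurable_torus_cos R)).
- exact: (measurableT_comp (measurable_crd 1)).
- exact: (measurableT_comp (@measurable_torus_sin R)).
Qed.

Definition slice_transform_meas (psi : torus R)
    (mu : {charge set (S2 R) -> \bar R}) : {charge set (Ibd R) -> \bar R} :=
  pushforward_charge (measurable_slice psi) mu.

Definition vertical_slice_transform_meas (mu : {charge set (S2 R) -> \bar R}) :
    {charge set (torus R * Ibd R)%type -> \bar R} :=
  pushforward_charge measurable_T_V (product_charge (torus_unif R) mu).

Lemma circle_subproof (psi : torus R) (t : Ibd R) (theta : R) :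
  let s := Num.sqrt (1 - Ival t ^+ 2) in
  (Ival t * torus_cos psi - s * cos theta * torus_sin psi) ^+ 2 +
  (Ival t * torus_sin psi + s * cos theta * torus_cos psi) ^+ 2 +
  (s * sin theta) ^+ 2 = 1.
Proof.
move=> s; have hs : s ^+ 2 = 1 - Ival t ^+ 2.
  rewrite sqr_sqrtr// subr_ge0 -(expr1n _ 2) -real_normK ?num_real//.
  rewrite ler_pXn2r ?nnegrE// ler_norml.
  by have := set_valP t; rewrite /= in_itv.
have h1 : torus_cos psi ^+ 2 + torus_sin psi ^+ 2 = 1 by exact: cos2Dsin2.
have h2 := cos2Dsin2 theta.
transitivity ((Ival t ^+ 2 + s ^+ 2 * cos theta ^+ 2) *
  (torus_cos psi ^+ 2 + torus_sin psi ^+ 2) + s ^+ 2 * sin theta ^+ 2).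
  by ring.
rewrite h1 mulr1 -addrA -mulrDr h2 mulr1 hs; ring.
Qed.

(* With e = (cos psi, sin psi, 0) and n = (- sin psi, cos psi, 0), the point
   t e + sqrt (1 - t^2) (cos theta n + sin theta e_3). For |t| < 1 this runs
   once through C_psi^t as theta runs through [0, 2 pi[. *)
Definition circle (psi : torus R) (t : Ibd R) (theta : R) : S2 R :=
  S2_pt (circle_subproof psi t theta).

Lemma polar_angle (u v : R) : u ^+ 2 + v ^+ 2 = 1 ->
  exists2 theta, 0 <= theta <= 2 * pi & cos theta = u /\ sin theta = v.
Proof.
move=> uv.
have u1 : -1 <= u <= 1.
  rewrite -ler_norml -(@ler_pXn2r _ 2)// ?nnegrE// real_normK ?num_real//.
  by rewrite expr1n -uv lerDl sqr_ge0.
have a0 := acos_ge0 u1; have api := acos_lepi u1.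
have sE : sin (acos u) = `|v|.
  by rewrite sin_acos// -uv addrC addKr sqrtr_sqr.
have [v0|v0] := leP 0 v.
  exists (acos u); first by rewrite a0/=; have := pi_ge0 R; lra.
  by rewrite acosK// sE ger0_norm.
exists (2 * pi - acos u); first by apply/andP; split; lra.
have -> : 2 * pi - acos u = - acos u + pi *+ 2 by rewrite mulr_natl addrC.
by rewrite cosD2pi sinD2pi cosN sinN acosK// sE ltr0_norm// opprK.
Qed.

Lemma circle_image psi (t : Ibd R) :
  circle psi t @` `[0, 2 * pi]%classic = slice psi @^-1` [set t].
Proof.
have cs : torus_cos psi ^+ 2 + torus_sin psi ^+ 2 = 1 by exact: cos2Dsin2.
apply/seteqP; split => [_ [th _ <-]|x xt].
  apply: val_inj => /=; rewrite /crd/= !mxE/=.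
  rewrite [RHS](_ : _ = Ival t * (torus_cos psi ^+ 2 + torus_sin psi ^+ 2)); last first.
    by rewrite cs mulr1.
  ring.
have {xt} tE : Ival t = crd 0 x * torus_cos psi + crd 1 x * torus_sin psi.
  by rewrite -xt.
have : \sum_(i < 3) crd i x ^+ 2 = 1 by exact: set_valP x.
rewrite !big_ord_recl big_ord0 addr0 addrA.
rewrite (_ : lift ord0 ord0 = 1); last exact: val_inj.
rewrite (_ : lift ord0 (lift ord0 ord0) = ord_max); last exact: val_inj.
set a := crd 0 x in tE *; set b := crd 1 x in tE *; set c := crd ord_max x => abc.
set C := torus_cos psi in cs tE *; set S := torus_sin psi in cs tE *.
set s := Num.sqrt (1 - Ival t ^+ 2).
have t2 : 1 - Ival t ^+ 2 = (b * C - a * S) ^+ 2 + c ^+ 2.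
  rewrite tE -abc -[a ^+ 2 + b ^+ 2]mulr1 -cs; ring.
have s2 : s ^+ 2 = (b * C - a * S) ^+ 2 + c ^+ 2.
  by rewrite sqr_sqrtr// t2 addr_ge0// sqr_ge0.
have [th th2 [h1 h2]] : exists2 theta, 0 <= theta <= 2 * pi &
    s * cos theta = b * C - a * S /\ s * sin theta = c.
  have [s0|s0] := eqVneq s 0.
    move: s2; rewrite s0 expr0n/= => /esym/eqP.
    rewrite paddr_eq0 ?sqr_ge0// !sqrf_eq0 => /andP[/eqP-> /eqP->].
    by exists 0; rewrite ?mul0r// lexx mulr_ge0// pi_ge0.
  have [|th th2 [h1 h2]] := @polar_angle ((b * C - a * S) / s) (c / s).
    by rewrite !expr_div_n -mulrDl -s2 divff// expf_neq0.
  by exists th => //; rewrite h1 h2 !(mulrC s) !divfK.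
exists th; first by rewrite /= in_itv.
apply: val_inj; apply/rowP => i; rewrite mxE.
rewrite -/s h1 h2 tE -/C -/S.
case: i => -[|[|[|//]]] i /=.
- transitivity (a * (C ^+ 2 + S ^+ 2)); first by ring.
  by rewrite cs mulr1 /a/crd; congr (_ _ _); exact: val_inj.
- transitivity (b * (C ^+ 2 + S ^+ 2)); first by ring.
  by rewrite cs mulr1 /b/crd; congr (_ _ _); exact: val_inj.
- by rewrite /c/crd; congr (_ _ _); exact: val_inj.
Qed.

(* integral of f with respect to arc length along the curve g on [a, b] *)
Definition arc_integral (g : R -> S2 R) (a b : R) (f : S2 R -> R) : \bar R :=
  (\int[@lebesgue_measure R]_(s in `[a, b])
     (f (g s) * (let v := vderive1 (fun r => \val (g r)) s in
                 Num.sqrt (dotp v v)))%:E)%E.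

(* If f is not ds-integrable on C_psi^t, the value is infinite (oo - oo = -oo),
   so that integrability of this function contains its being well defined
   almost everywhere. For t = 1 and t = -1 the circle is the single point
   t (cos psi, sin psi, 0). *)
Definition vertical_slice_transform (f : S2 R -> R) (p : torus R * Ibd R) :
    \bar R :=
  let t := Ival p.2 in
  if -1 < t < 1 then
    ((2 * pi * Num.sqrt (1 - t ^+ 2))^-1%:E *
      arc_integral (circle p.1 p.2) 0 (2 * pi) f)%E
  else (f (circle p.1 p.2 0))%:E.

Definition slice_transform (psi : torus R) (f : S2 R -> R) (t : Ibd R) :
  \bar R := ((2 * pi)%:E * vertical_slice_transform f (psi, t))%E.

End transforms.

(* Main.v *)
From HB Require Import structures.
Require Import Defs.
From mathcomp Require Import all_boot all_order all_algebra.
From mathcomp Require Import all_classical all_reals all_analysis.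
From mathcomp Require Import measurable_realfun ring lra.

(** Everything rests on one identity: for a measurable [g >= 0] on the sphere
    and any [psi],
      int_{S^2} g dsigma
        = int_{-1}^{1} int_0^{2 pi} g (circle psi t alpha) dalpha dt,
    which is [ge0_integral_slices].  Along the circle [C_psi^t] arc length is
    [sqrt (1 - t^2) dalpha]; this factor cancels the weight in the definition of
    the transform, so that [V_psi g (t)] is the inner integral above whenever
    [|t| < 1], that is for almost every [t].  As [S_psi] is constant equal to
    [t] on [C_psi^t], multiplying [g] by the indicator of [S_psi^-1 (A)] turns
    the identity into [V_psi (g sigma) (A) = int_A V_psi g].  Splitting [f] into
    its positive and negative parts gives the statement for a fixed [psi]
    ([integral_slice_transform]).  The statement on the product of the torus and
    the interval follows by integrating it over [psi]: by definition
    [V (f sigma) (A)] is the mean over [psi] of [V_psi (f sigma)] on the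
    sections of [A], and by Fubini so is [int_A V f], the factor [(2 pi)^-1] of
    the uniform law being the one between [V f (psi, .)] and [V_psi f]
    ([vertical_slice_transform_measE]).

    For the identity itself, the surface measure is given in longitude [phi] and
    colatitude [theta], with polar axis [e_3]; with [z = cos theta] it is the
    measure [dphi dz], while the slicing circles turn about the horizontal axis
    [cos psi e_1 + sin psi e_2].  A translation of [phi] reduces to the axis
    [e_1], and what remains is to exchange the polar axes [e_3] and [e_1]
    ([zone_swap]).  Project each of the hemispheres [y > 0] and [y < 0] on the
    disc of the plane [(x, z)]: for fixed [z], the substitution
    [x = sqrt (1 - z^2) cos phi] turns [dphi dz] into
    [dx dz / sqrt (1 - x^2 - z^2)], which is symmetric in [x] and [z].  By
    Tonelli the same density comes from the measure [dalpha dx] of the other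
    axis.  Only a substitution in one variable is therefore used, and no change
    of variables in the plane; it is proved for all nonnegative measurable
    functions by comparing two measures on half-lines. *)

Set Implicit Arguments.
Unset Strict Implicit.
Unset Printing Implicit Defensive.

Import Order.TTheory GRing.Theory Num.Theory.
Import numFieldNormedType.Exports.

Local Open Scope classical_set_scope.
Local Open Scope ring_scope.
Local Open Scope ereal_scope.

(** * Images of weighted measures *)

Section weighted_image.

Import HBNNSimple.

(** It is enough to know [nu] on sets: the hypothesis is the conclusion for
    indicator functions, and both sides are linear and continuous along
    increasing sequences of simple functions. *)
Lemma ge0_integral_weighted d1 d2 (X : measurableType d1) (Y : measurableType d2)
    (R : realType) (m : {measure set X -> \bar R}) (nu : {measure set Y -> \bar R})
    (D : set X) (T : X -> Y) (w : X -> R) :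
  measurable D -> measurable_fun setT T -> measurable_fun setT w ->
  (forall x, D x -> (0 <= w x)%R) ->
  (forall A, measurable A -> nu A = \int[m]_(x in D `&` T @^-1` A) (w x)%:E) ->
  forall g : Y -> \bar R, measurable_fun setT g -> (forall y, 0 <= g y) ->
  \int[nu]_y g y = \int[m]_(x in D) (g (T x) * (w x)%:E).
Proof.
move=> mD mT mw w0 nuE g mg g0.
have mwD : measurable_fun D (EFin \o w).
  by apply/measurable_EFinP; exact: measurable_funTS.
have mTA A : measurable A -> measurable (T @^-1` A).
  by move=> mA; rewrite -[X in measurable X]setTI; exact: mT.
pose g_ := nnsfun_approx measurableT mg.
have cvg_g y : (g_ n y)%:E @[n --> \oo] --> g y by exact: cvg_nnsfun_approx.
have nd_g y (i j : nat) : (i <= j)%N -> (g_ i y <= g_ j y)%R.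
  by move=> ij; exact/lefP/nd_nnsfun_approx.
have mgT n : measurable_fun D (fun x => (g_ n (T x))%:E * (w x)%:E).
  apply: emeasurable_funM => //; apply/measurable_EFinP.
  by apply: measurable_funTS; apply: measurableT_comp.
transitivity (limn (fun n => \int[nu]_y (g_ n y)%:E)).
  rewrite -monotone_convergence//.
  - by apply: eq_integral => y _; apply/esym/cvg_lim.
  - by move=> n; exact/measurable_EFinP.
  - by move=> n y _; rewrite lee_fin.
  - by move=> y _ i j ij; rewrite lee_fin nd_g.
transitivity (limn (fun n => \int[m]_(x in D) ((g_ n (T x))%:E * (w x)%:E))); last first.
  rewrite -monotone_convergence//.
  - apply: eq_integral => x /[!inE] Dx; apply/cvg_lim => //.
    by apply: cvgeMr.
  - by move=> n x Dx; rewrite mule_ge0// lee_fin// w0.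
  - by move=> x Dx i j ij; rewrite lee_wpmul2r// lee_fin ?w0// nd_g.
congr (limn _); apply/funext => n.
have mk k : measurable (g_ n @^-1` [set k]) by exact: measurable_sfunP.
transitivity (\sum_(k \in range (g_ n)) k%:E * nu (g_ n @^-1` [set k])).
  rewrite integralT_nnsfun sintegralE//.
under [RHS]eq_integral => x _.
  rewrite fimfunE -fsumEFin// ge0_mule_fsuml; last first.
    by move=> k; rewrite EFinM nnfun_muleindic_ge0.
  over.
rewrite ge0_integral_fsum//; last 2 first.
  - move=> k; apply: emeasurable_funM => //; apply/measurable_EFinP.
    apply: measurable_funTS; apply: measurable_funM => //.
    by apply: measurableT_comp.
  - by move=> k x Dx; rewrite mule_ge0 ?EFinM ?nnfun_muleindic_ge0// lee_fin w0.
apply: eq_fsbigr => k /[!inE] -[y _ <-].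
under eq_integral => x _ do rewrite EFinM -muleA.
rewrite ge0_integralZl_EFin//; last 2 first.
  - by move=> x Dx; rewrite mule_ge0 ?lee_fin ?w0.
  - apply: emeasurable_funM => //; apply/measurable_EFinP.
    by apply: measurable_funTS; apply: measurableT_comp.
congr (_ * _); rewrite nuE// integral_mkcondr; apply: eq_integral => x _.
rewrite epatch_indic indicE muleC; congr (_ * _%:E).
Qed.

End weighted_image.

(** The half-lines form a generating pi-system, exhausted by those of integral
    endpoint, so that two measures finite on them agree as soon as they agree
    on them. *)
Lemma weighted_image_rayP d (X : measurableType d) (R : realType)
    (m : {measure set X -> \bar R}) (nu : {measure set (measurableTypeR R) -> \bar R})
    (D : set X) (T : X -> measurableTypeR R) (w : X -> R) :
  measurable D -> measurable_fun setT T -> measurable_fun setT w ->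
  (forall x, D x -> (0 <= w x)%R) ->
  (forall a : R, nu `]-oo, a[%classic < +oo) ->
  (forall a : R, nu `]-oo, a[%classic =
     \int[m]_(x in D `&` T @^-1` `]-oo, a[%classic) (w x)%:E) ->
  forall A, measurable A -> nu A = \int[m]_(x in D `&` T @^-1` A) (w x)%:E.
Proof.
move=> mD mT mw w0 nufin nuE A mA.
have mTA B : measurable B -> measurable (D `&` T @^-1` B).
  move=> mB; apply: measurableI => //.
  by rewrite -[X in measurable X]setTI; exact: mT.
pose rho (B : set (measurableTypeR R)) := \int[m]_(x in D `&` T @^-1` B) (w x)%:E.
have rho0 : rho set0 = 0 by rewrite /rho preimage_set0 setI0 integral_set0.
have rho_ge0 B : 0 <= rho B.
  by apply: integral_ge0 => x -[Dx _]; rewrite lee_fin w0.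
have rho_sa : semi_sigma_additive rho.
  move=> F mF tF mUF; rewrite /rho preimage_bigcup setI_bigcupr.
  rewrite ge0_integral_bigcup//=.
  - apply: is_cvg_ereal_nneg_natsum_cond => n _ _.
    exact: rho_ge0.
  - by move=> n; exact: mTA.
  - by apply: measurable_funTS; exact/measurable_EFinP.
  - by move=> x [n _ [Dx _]]; rewrite lee_fin w0.
  - apply/trivIsetP => i j _ _ ij; rewrite -subset0 => x [[_ Fi] [_ Fj]].
    have : (F i `&` F j) (T x) by [].
    by move/trivIsetP : tF => /(_ _ _ I I ij) ->.
pose rhoM : {measure set (measurableTypeR R) -> \bar R} :=
  HB.pack rho (isMeasure.Build _ _ _ rho rho0 rho_ge0 rho_sa).
apply: (@measure_unique _ R (measurableTypeR R) (@RGenInftyO.G R)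
  (fun n => `]-oo, n%:R[%classic) _ _ _ _ nu rhoM _ _ A).
- exact: RGenInftyO.measurableE.
- move=> _ _ [a ->] [b ->]; exists (Num.min a b).
  by apply/seteqP; split => x /=; rewrite !in_itv/= lt_min => /andP.
- by move=> n; exists n%:R.
- apply/seteqP; split => // x _; exists (Num.truncn `|x|).+1 => //=.
  rewrite in_itv/= (le_lt_trans (ler_norm x))//.
  by rewrite truncnS_gt.
- by move=> _ [a ->]; exact: nuE.
- by [].
- exact: mA.
Qed.

(** * The substitution [x = r cos theta] *)

Section cos_substitution.
Variable R : realType.
Local Notation mu := (@lebesgue_measure R).

Lemma measurable_cos : measurable_fun [set: R] (@cos R).
Proof. by apply: continuous_measurable_fun; exact: continuous_cos. Qed.

Lemma measurable_sin : measurable_fun [set: R] (@sin R).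
Proof. by apply: continuous_measurable_fun; exact: continuous_sin. Qed.

Lemma integral_sin (r u : R) : (0 <= u <= pi)%R ->
  \int[mu]_(x in `[u, pi]) (r * sin x)%:E = (r * (1 + cos u))%:E.
Proof.
move=> /andP[u0]; rewrite le_eqVlt => /predU1P[->|upi].
  by rewrite set_itv1 integral_set1 cospi subrr mulr0.
rewrite (@continuous_FTC2 _ _ (fun x => - r * cos x)%R)//.
- by rewrite cospi -EFinB; congr EFin; ring.
- apply: continuous_subspaceT => x.
  by apply: cvgM; [exact: cvg_cst|exact: continuous_sin].
- split => [x _| |].
  + by apply: derivableM.
  + apply: cvg_at_right_filter; apply: cvgM; first exact: cvg_cst.
    exact: continuous_cos.
  + apply: cvg_at_left_filter; apply: cvgM; first exact: cvg_cst.
    exact: continuous_cos.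
- move=> x _; rewrite derive1E derive_val /GRing.scale/=; ring.
Qed.

Lemma ge0_integral_mrestr d (X : measurableType d) (m : {measure set X -> \bar R})
    (D : set X) (mD : measurable D) (g : X -> \bar R) :
  measurable_fun setT g -> (forall x, 0 <= g x) ->
  \int[mrestr m mD]_x g x = \int[m]_(x in D) g x.
Proof.
move=> mg g0; rewrite (@ge0_integral_weighted _ _ _ _ R m (mrestr m mD) D id (cst 1%R))//.
  by apply: eq_integral => x _; rewrite mule1.
move=> A mA; rewrite [RHS](eq_integral (cst 1))// integral_cst ?mul1e;
  last exact: measurableI.
by rewrite /mrestr setIC.
Qed.

(** Both sides integrate [g] against a finite measure; on the half-line of
    points below [a], with [|a| <= r], each of the two has mass [a + r], because
    [r cos theta < a] exactly when [theta > acos (a / r)]. *)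
Lemma ge0_integral_substitution_cos (r : R) (g : R -> \bar R) : (0 < r)%R ->
  measurable_fun setT g -> (forall x, 0 <= g x) ->
  \int[mu]_(x in `[(- r)%R, r]) g x =
  \int[mu]_(x in `[0%R, pi]) (g (r * cos x)%R * (r * sin x)%:E).
Proof.
move=> r0 mg g0.
pose D : set R := `[(- r)%R, r]%classic.
have mD : measurable D by exact: measurable_itv.
transitivity (\int[mrestr mu mD]_x g x); first by rewrite ge0_integral_mrestr.
have mT : measurable_fun setT (fun x : R => r * cos x)%R.
  by apply: measurable_funM => //; exact: measurable_cos.
have mw : measurable_fun setT (fun x : R => r * sin x)%R.
  by apply: measurable_funM => //; exact: measurable_sin.
have w0 (x : R) : `[0%R, pi]%classic x -> (0 <= r * sin x)%R.
  by rewrite /= in_itv/= => xpi; apply: mulr_ge0; [exact: ltW|exact: sin_ge0_pi].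
apply: ge0_integral_weighted => //.
apply: (@weighted_image_rayP _ _ R mu (mrestr mu mD)) => // a.
  apply: (@le_lt_trans _ _ (mu D)).
    apply: (@le_measure _ _ _ mu); rewrite ?inE//; apply: measurableI => //.
  by rewrite /D/= lebesgue_measure_itv/=; case: ifPn; rewrite ?ltry.
transitivity (mu (`]-oo, a[%classic `&` D)); first by [].
have rN : (- r < r)%R by lra.
have [ar|ra] := leP a (- r)%R.
  rewrite (_ : _ `&` D = set0) ?measure0; last first.
    by apply/seteqP; split => // x []; rewrite /D/= !in_itv/=; lra.
  rewrite (_ : _ `&` _ = set0) ?integral_set0//.
  apply/seteqP; split => // x []; rewrite /= !in_itv/= => _ h.
  by have := cos_geN1 x; nra.
have [ra'|ar] := ltP r a.
  rewrite (_ : _ `&` D = D); last first.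
    by apply/seteqP; split => [x []//|x]; rewrite /D/= !in_itv/=; split => //; lra.
  rewrite (_ : _ `&` _ = `[0%R, pi]%classic); last first.
    apply/seteqP; split => [x []//|x xpi]; split => //.
    by rewrite /= in_itv/=; have := cos_le1 x; nra.
  rewrite integral_sin ?lexx ?pi_ge0// cos0 /D/= lebesgue_measure_itv/= lte_fin rN.
  by rewrite -EFinB; congr EFin; ring.
have ar1 : (-1 <= a / r <= 1)%R.
  by rewrite ler_pdivlMr// ler_pdivrMr//; apply/andP; split; lra.
have acos_pi := acos_lepi ar1; have acos0 := acos_ge0 ar1.
have cosacos : cos (acos (a / r)) = (a / r)%R by rewrite acosK.
rewrite (_ : _ `&` D = `[(- r)%R, a[%classic); last first.
  by apply/seteqP; split => [x []|x]; rewrite /D/= !in_itv/=; lra.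
rewrite (_ : `[0%R, pi] `&` _ = `]acos (a / r), pi]%classic); last first.
  apply/seteqP; split => x; rewrite /= !in_itv/=.
    move=> [/= x0pi rx]; have /andP[x0 xpi] := x0pi; rewrite xpi andbT.
    by rewrite -ltr_cos ?in_itv/= ?acos0// cosacos ltr_pdivlMr// mulrC.
  move=> /andP[ax xpi]; have x0 : (0 <= x)%R by apply: le_trans acos0 (ltW ax).
  rewrite x0 xpi; split => //; rewrite mulrC -ltr_pdivlMr//.
  by rewrite -cosacos ltr_cos ?in_itv/= ?acos0 ?x0.
rewrite integral_itv_obnd_cbnd; last first.
  by apply/measurable_EFinP; exact: measurable_funTS.
rewrite integral_sin ?acos0// cosacos lebesgue_measure_itv/= lte_fin ra.
by rewrite -EFinB; congr EFin; field; rewrite gt_eqF.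
Qed.

End cos_substitution.

(** * Integrals over a period *)

Section periodic_integrals.
Variable R : realType.
Local Notation mu := (@lebesgue_measure R).
Implicit Types (D : set R) (g : R -> \bar R) (a b c : R).

Lemma ge0_integral_shift a D g : measurable D ->
  measurable_fun setT g -> (forall x, 0 <= g x) ->
  \int[mu]_(x in D) g x = \int[mu]_(x in +%R^~ a @^-1` D) g (x + a)%R.
Proof.
move=> mD mg g0.
have ma : measurable_fun [set: measurableTypeR R]
    (+%R^~ a : measurableTypeR R -> measurableTypeR R).
  by apply: measurable_funD.
rewrite -[RHS](@ge0_integral_pushforward _ _ _ _ R _ ma mu D g)//; last first.
  exact: measurable_funTS.
apply: eq_measure_integral => //= A mA _; apply: lebesgue_measure_unique => //=.
move=> _ [[u v]] _ <-; rewrite /pushforward/=.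
rewrite (_ : +%R^~ a @^-1` `]u, v] = `]u - a, v - a]%classic)%R; last first.
  by apply/seteqP; split => x /=; rewrite !in_itv/=; lra.
rewrite !lebesgue_measure_itv/= !lte_fin ltrD2r -!EFinB.
by case: ifP => // _; congr EFin; ring.
Qed.

Lemma ge0_integral_opp D g : measurable D ->
  measurable_fun setT g -> (forall x, 0 <= g x) ->
  \int[mu]_(x in D) g x = \int[mu]_(x in -%R @^-1` D) g (- x)%R.
Proof.
move=> mD mg g0.
rewrite -[RHS](@ge0_integral_pushforward _ _ _ _ R
  (-%R : measurableTypeR R -> measurableTypeR R) _ mu D g)//; last first.
  exact: measurable_funTS.
by apply: eq_measure_integral => //= A mA _; exact/esym/lebesgue_measureN.
Qed.

Lemma ge0_integral_itv_split a b c g : (a <= b <= c)%R ->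
  measurable_fun setT g -> (forall x, 0 <= g x) ->
  \int[mu]_(x in `[a, c]) g x =
  \int[mu]_(x in `[a, b]) g x + \int[mu]_(x in `[b, c]) g x.
Proof.
move=> /andP[ab bc] mg g0.
rewrite -[X in _ = X + _]integral_itv_bndo_bndc; last exact: measurable_funTS.
rewrite -ge0_integral_setU//=.
- congr (integral _ _ _); apply/seteqP; split => x /=; rewrite !in_itv/=.
    by have [h1 h2|h1 h2] := leP b x; [right|left]; lra.
  by case; lra.
- exact: measurable_funTS.
- by apply/disj_setPS => x [] /=; rewrite !in_itv/=; lra.
Qed.

Variable k : R -> \bar R.
Hypotheses (mk : measurable_fun setT k) (k0 : forall x, 0 <= k x).
Hypothesis kp : forall x, k (x + 2 * pi)%R = k x.

Let pi0 : (0 <= pi :> R)%R. Proof. exact: pi_ge0. Qed.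

(** The interval [[a, a + 2 pi]] is cut at [2 pi], and the part beyond [2 pi] is
    brought back to [[0, a]] by periodicity. *)
Lemma ge0_integral_period_shift a : (0 <= a <= 2 * pi)%R ->
  \int[mu]_(x in `[0%R, (2 * pi)%R]) k (x + a)%R =
  \int[mu]_(x in `[0%R, (2 * pi)%R]) k x.
Proof.
move=> /andP[a0 a2].
transitivity (\int[mu]_(x in `[a, (a + 2 * pi)%R]) k x).
  rewrite [RHS](@ge0_integral_shift a)//.
  by congr (integral _ _ _); apply/seteqP; split => x /=; rewrite !in_itv/=; lra.
rewrite (@ge0_integral_itv_split a (2 * pi)%R)//; last by apply/andP; split; lra.
rewrite [RHS](@ge0_integral_itv_split _ a)//; last by apply/andP; split; lra.
rewrite addeC; congr (_ + _); rewrite (@ge0_integral_shift (2 * pi)%R)//.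
under eq_integral do rewrite kp.
by congr (integral _ _ _); apply/seteqP; split => x /=; rewrite !in_itv/=; lra.
Qed.

Lemma ge0_integral_period_opp :
  \int[mu]_(x in `[0%R, (2 * pi)%R]) k (- x)%R =
  \int[mu]_(x in `[0%R, (2 * pi)%R]) k x.
Proof.
rewrite [RHS](@ge0_integral_shift (2 * pi)%R)//.
under [RHS]eq_integral do rewrite kp.
rewrite [RHS]ge0_integral_opp//; last first.
  by rewrite -[X in measurable X]setTI; apply: (measurable_funD (f := id)).
by congr (integral _ _ _); apply/seteqP; split => x /=; rewrite !in_itv/=; lra.
Qed.

(** This cuts a circle into its two halves: with [x] and [- x] as the angles,
    the cosine is the same and the sine changes sign. *)
Lemma ge0_integral_period_fold :
  \int[mu]_(x in `[0%R, (2 * pi)%R]) k x =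
  \int[mu]_(x in `[0%R, pi]) (k x + k (- x)%R).
Proof.
have mkN : measurable_fun setT (fun x : R => k (- x)%R) by exact: measurableT_comp.
rewrite ge0_integralD//; [|exact: measurable_funTS|exact: measurable_funTS].
rewrite (@ge0_integral_itv_split 0%R pi (2 * pi)%R)//; last first.
  by rewrite pi_ge0 ler_peMl ?pi_ge0 ?ler1n.
congr (_ + _); rewrite [LHS](@ge0_integral_shift (2 * pi)%R)//.
under [LHS]eq_integral do rewrite kp.
rewrite [in LHS]ge0_integral_opp//; last first.
  by rewrite -[X in measurable X]setTI; apply: (measurable_funD (f := id)).
by congr (integral _ _ _); apply/seteqP; split => x /=; rewrite !in_itv/=; lra.
Qed.

End periodic_integrals.

(** * Tonelli's theorem on a product of two sets *)

Section tonelli_on_rectangles.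
Context d1 d2 (T1 : measurableType d1) (T2 : measurableType d2) (R : realType).
Variables (m1 : {sigma_finite_measure set T1 -> \bar R})
          (m2 : {sigma_finite_measure set T2 -> \bar R}).
Variables (D1 : set T1) (D2 : set T2) (f : T1 * T2 -> \bar R).
Hypotheses (mD1 : measurable D1) (mD2 : measurable D2).
Hypotheses (mf : measurable_fun setT f) (f0 : forall p, 0 <= f p).

Let fD := f \_ (D1 `*` D2).

Let mfD : measurable_fun setT fD.
Proof.
by apply/(measurable_restrictT _ (measurableX mD1 mD2)); exact: measurable_funTS.
Qed.

Let fD0 p : 0 <= fD p. Proof. by rewrite /fD/patch; case: ifP. Qed.

Lemma tonelli_rectangle :
  \int[m1 \x m2]_(p in D1 `*` D2) f p =
  \int[m1]_(x in D1) \int[m2]_(y in D2) f (x, y).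
Proof.
rewrite integral_mkcond (fubini_tonelli1 _ mfD fD0) [RHS]integral_mkcond.
apply: eq_integral => x _; rewrite /fubini_F /patch; case: ifPn => xD.
  rewrite [RHS]integral_mkcond; apply: eq_integral => y _.
  by rewrite /fD /patch in_setX/= xD.
by apply: integral0_eq => y _; rewrite /fD /patch in_setX/= (negbTE xD).
Qed.

Lemma tonelli_rectangle_swap :
  \int[m1]_(x in D1) \int[m2]_(y in D2) f (x, y) =
  \int[m2]_(y in D2) \int[m1]_(x in D1) f (x, y).
Proof.
rewrite -tonelli_rectangle integral_mkcond (fubini_tonelli2 _ mfD fD0).
rewrite [RHS]integral_mkcond.
apply: eq_integral => y _; rewrite /fubini_G /patch; case: ifPn => yD.
  rewrite [RHS]integral_mkcond; apply: eq_integral => x _.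
  by rewrite /fD /patch in_setX/= yD andbT.
by apply: integral0_eq => x _; rewrite /fD /patch in_setX/= (negbTE yD) andbF.
Qed.

End tonelli_on_rectangles.

Lemma measurable_integral_in d1 d2 (T1 : measurableType d1)
    (T2 : measurableType d2) (R : realType)
    (m2 : {sigma_finite_measure set T2 -> \bar R}) (D2 : set T2)
    (f : T1 * T2 -> \bar R) : measurable D2 ->
  measurable_fun setT f -> (forall p, 0 <= f p) ->
  measurable_fun setT (fun x => \int[m2]_(y in D2) f (x, y)).
Proof.
move=> mD2 mf f0.
rewrite (_ : (fun _ => _) = fubini_F m2 (f \_ ([set: T1] `*` D2))); last first.
  apply/funext => x; rewrite /fubini_F [LHS]integral_mkcond; apply: eq_integral => y _.
  by rewrite /patch in_setX/= in_setT.
apply: measurable_fun_fubini_tonelli_F.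
- apply/(measurable_restrictT _ (measurableX measurableT mD2)).
  exact: measurable_funTS.
- by move=> p; rewrite /patch; case: ifP.
Qed.

(** * Exchanging the polar axes of the sphere *)

Section zones.
Variable R : realType.
Local Notation mu := (@lebesgue_measure R).

Lemma measurable_sqrt : measurable_fun [set: R] (@Num.sqrt R).
Proof. by apply: continuous_measurable_fun; exact: sqrt_continuous. Qed.

Lemma measurable_sqrtV : measurable_fun [set: R] (fun x => (Num.sqrt x)^-1)%R.
Proof.
rewrite (_ : (fun _ => _) = (fun x => Num.sqrt x `^ (-1))%R); last first.
  by apply/funext => x; rewrite powR_inv1 ?sqrtr_ge0.
have mV := @measurable_powR R (-1)%R; exact: (measurableT_comp mV measurable_sqrt).
Qed.

Lemma measurable_Bsqr (c : R) : measurable_fun [set: R] (fun x => c - x ^+ 2)%R.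
Proof. by apply: measurable_funB => //; exact: exprn_measurable. Qed.

(** The substitution [x = r cos phi], with [dx = r sin phi dphi] up to sign and
    [r sin phi = sqrt (r^2 - x^2)].  The integral on the right runs over the
    whole line: when [|x| >= r], the square root is [0] and so is its inverse,
    and the integrand vanishes. *)
Lemma ge0_integral_half_circle (r : R) (h : R -> \bar R) : (0 < r)%R ->
  measurable_fun setT h -> (forall x, 0 <= h x) ->
  \int[mu]_(phi in `[0%R, pi]) h (r * cos phi)%R =
  \int[mu]_x (h x * ((Num.sqrt (r ^+ 2 - x ^+ 2))^-1)%:E).
Proof.
move=> r0 mh h0.
have mk : measurable_fun setT
    (fun x : R => h x * ((Num.sqrt (r ^+ 2 - x ^+ 2))^-1)%:E).
  apply: emeasurable_funM => //; apply/measurable_EFinP.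
  apply: (measurableT_comp measurable_sqrtV); exact: measurable_Bsqr.
have k0 x : 0 <= h x * ((Num.sqrt (r ^+ 2 - x ^+ 2))^-1)%:E.
  by rewrite mule_ge0// lee_fin invr_ge0 sqrtr_ge0.
transitivity (\int[mu]_(x in `[(- r)%R, r])
    (h x * ((Num.sqrt (r ^+ 2 - x ^+ 2))^-1)%:E)); last first.
  rewrite integral_mkcond; apply: eq_integral => x _; rewrite /patch.
  case: ifPn => //; rewrite notin_setE/= in_itv/= => xr.
  rewrite ler0_sqrtr ?invr0 ?mule0// subr_le0 leNgt; apply: contra_notN xr.
  rewrite -ltr_sqrt ?exprn_gt0// !sqrtr_sqr (gtr0_norm r0) ltr_norml.
  by move=> /andP[/ltW-> /ltW->].
rewrite ge0_integral_substitution_cos//.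
rewrite integral_itv_bndoo; last first.
  apply: measurable_funTS; apply: measurableT_comp => //.
  by apply: measurable_funM => //; exact: measurable_cos.
rewrite [RHS]integral_itv_bndoo; last first.
  apply: measurable_funTS; apply: emeasurable_funM.
    apply: (measurableT_comp mk).
    by apply: measurable_funM => //; exact: measurable_cos.
  apply/measurable_EFinP.
  by apply: measurable_funM => //; exact: measurable_sin.
apply: eq_integral => x; rewrite inE/= in_itv/= => x0pi.
have s0 : (0 < r * sin x)%R by rewrite mulr_gt0// sin_gt0_pi.
rewrite (_ : r ^+ 2 - (r * cos x) ^+ 2 = (r * sin x) ^+ 2)%R; last first.
  by rewrite !exprMn sin2cos2; ring.
by rewrite sqrtr_sqr gtr0_norm// -muleA -EFinM mulVf ?mule1// gt_eqF.
Qed.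

(** Functions on space are taken with three arguments; this is how their
    measurability passes to curves and surfaces. *)
Lemma measurable_fun3 (q : R -> R -> R -> \bar R) :
  measurable_fun setT (fun p : R * R * R => q p.1.1 p.1.2 p.2) ->
  forall d (T : measurableType d) (a b c : T -> R), measurable_fun setT a ->
    measurable_fun setT b -> measurable_fun setT c ->
  measurable_fun setT (fun t => q (a t) (b t) (c t)).
Proof.
move=> mq d T a b c ma mb mc.
apply: (@measurableT_comp _ _ _ _ _ _ _ _ (fun t => (a t, b t, c t)) mq).
by apply: measurable_fun_pair => //; apply: measurable_fun_pair.
Qed.

(** The circle at height [z] has radius [sqrt (1 - z^2)] and is projected on the
    [x] axis, the two terms [y = sqrt (1 - z^2 - x^2)] and its opposite being
    its two halves.  The poles [z = 1] and [z = -1] are discarded first: there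
    the radius vanishes and the substitution is not available. *)
Lemma zone_hemispheres (q : R -> R -> R -> \bar R) :
  measurable_fun setT (fun p : R * R * R => q p.1.1 p.1.2 p.2) ->
  (forall x y z, 0 <= q x y z) ->
  \int[mu]_(z in `[(-1)%R, 1%R]) \int[mu]_(phi in `[0%R, (2 * pi)%R])
    q (Num.sqrt (1 - z ^+ 2) * cos phi)%R (Num.sqrt (1 - z ^+ 2) * sin phi)%R z =
  \int[mu]_z \int[mu]_x
    ((q x (Num.sqrt (1 - z ^+ 2 - x ^+ 2)) z +
      q x (- Num.sqrt (1 - z ^+ 2 - x ^+ 2))%R z) *
     ((Num.sqrt (1 - z ^+ 2 - x ^+ 2))^-1)%:E).
Proof.
move=> mq q0.
have mqc := measurable_fun3 mq.
have mrad : measurable_fun setT (fun z : R => Num.sqrt (1 - z ^+ 2))%R.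
  apply: (measurableT_comp measurable_sqrt); exact: measurable_Bsqr.
rewrite integral_itv_bndoo; last first.
  apply: measurable_funTS.
  apply: (@measurable_integral_in _ _ (measurableTypeR R) (measurableTypeR R) R
    mu _ (fun p : R * R => q (Num.sqrt (1 - p.1 ^+ 2) * cos p.2)%R
                (Num.sqrt (1 - p.1 ^+ 2) * sin p.2)%R p.1)) => //.
  apply: mqc => //.
  - apply: measurable_funM; first exact: measurableT_comp mrad _.
    exact: measurableT_comp (@measurable_cos R) _.
  - apply: measurable_funM; first exact: measurableT_comp mrad _.
    exact: measurableT_comp (@measurable_sin R) _.
rewrite integral_mkcond; apply: eq_integral => z _; rewrite /patch.
case: ifPn => [|]; last first.
  rewrite notin_setE/= in_itv/= => z1; apply/esym/integral0_eq => x _.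
  rewrite ler0_sqrtr ?invr0 ?mule0//.
  rewrite (@le_trans _ _ (1 - z ^+ 2)%R) ?gerBl ?sqr_ge0// subr_le0.
  rewrite leNgt; apply: contra_notN z1.
  rewrite -[X in (_ < X)%R](expr1n _ 2) -ltr_sqrt ?exprn_gt0// !sqrtr_sqr normr1.
  by rewrite ltr_norml.
rewrite inE/= in_itv/= => z1; set r := Num.sqrt (1 - z ^+ 2).
have z2 : (0 < 1 - z ^+ 2)%R by move: z1 => /andP[]; nra.
have r0 : (0 < r)%R by rewrite sqrtr_gt0.
have r2 : (r ^+ 2 = 1 - z ^+ 2)%R by rewrite sqr_sqrtr// ltW.
rewrite ge0_integral_period_fold//; last 2 first.
- by apply: mqc => //; apply: measurable_funM => //;
    [exact: measurable_cos|exact: measurable_sin].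
- by move=> x; rewrite mulr_natl cosD2pi sinD2pi.
rewrite -r2.
rewrite -(@ge0_integral_half_circle r (fun x =>
    q x (Num.sqrt (r ^+ 2 - x ^+ 2)) z + q x (- Num.sqrt (r ^+ 2 - x ^+ 2))%R z))//.
- apply: eq_integral => x; rewrite inE/= in_itv/= => x0pi.
  rewrite (_ : r ^+ 2 - (r * cos x) ^+ 2 = (r * sin x) ^+ 2)%R; last first.
    by rewrite !exprMn sin2cos2; ring.
  rewrite sqrtr_sqr ger0_norm; last by rewrite mulr_ge0 ?sin_ge0_pi// ltW.
  by rewrite cosN sinN mulrN.
- have ms : measurable_fun setT (fun x : R => Num.sqrt (r ^+ 2 - x ^+ 2))%R.
    apply: (measurableT_comp measurable_sqrt); exact: measurable_Bsqr.
  by apply: emeasurable_funD; apply: mqc => //; apply: measurableT_comp.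
- by move=> x; rewrite adde_ge0.
Qed.

(** The left-hand side has polar axis [e_3] and the right-hand side [e_1].  In
    the form of [zone_hemispheres] they only differ by the order of the two
    integrations. *)
Lemma zone_swap (q : R -> R -> R -> \bar R) :
  measurable_fun setT (fun p : R * R * R => q p.1.1 p.1.2 p.2) ->
  (forall x y z, 0 <= q x y z) ->
  \int[mu]_(z in `[(-1)%R, 1%R]) \int[mu]_(phi in `[0%R, (2 * pi)%R])
    q (Num.sqrt (1 - z ^+ 2) * cos phi)%R (Num.sqrt (1 - z ^+ 2) * sin phi)%R z =
  \int[mu]_(x in `[(-1)%R, 1%R]) \int[mu]_(phi in `[0%R, (2 * pi)%R])
    q x (Num.sqrt (1 - x ^+ 2) * sin phi)%R (Num.sqrt (1 - x ^+ 2) * cos phi)%R.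
Proof.
move=> mq q0.
have mqc := measurable_fun3 mq.
have mq' : measurable_fun setT (fun p : R * R * R => q p.2 p.1.2 p.1.1).
  apply: (mqc _ _ snd (snd \o fst) (fst \o fst)) => //.
    exact: measurableT_comp measurable_snd measurable_fst.
  exact: measurableT_comp measurable_fst measurable_fst.
rewrite (zone_hemispheres mq q0).
rewrite (@zone_hemispheres (fun x y z => q z y x) mq' (fun x y z => q0 z y x)).
rewrite (@fubini_tonelli _ _ _ _ _ mu mu (fun p =>
    (q p.2 (Num.sqrt (1 - p.1 ^+ 2 - p.2 ^+ 2)) p.1 +
      q p.2 (- Num.sqrt (1 - p.1 ^+ 2 - p.2 ^+ 2))%R p.1) *
     ((Num.sqrt (1 - p.1 ^+ 2 - p.2 ^+ 2))^-1)%:E))/=.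
- apply: eq_integral => x _; apply: eq_integral => z _.
  by rewrite (_ : 1 - z ^+ 2 - x ^+ 2 = 1 - x ^+ 2 - z ^+ 2)%R//; ring.
- have mr : measurable_fun setT (fun p : R * R => 1 - p.1 ^+ 2 - p.2 ^+ 2)%R.
    by apply: measurable_funB; [apply: measurable_funB => //|];
      apply: measurable_funX.
  have ms := measurableT_comp measurable_sqrt mr.
  apply: emeasurable_funM.
    by apply: emeasurable_funD; apply: mqc => //; apply: measurableT_comp.
  by apply/measurable_EFinP; exact: (measurableT_comp measurable_sqrtV mr).
- by move=> p; rewrite mule_ge0 ?adde_ge0// lee_fin invr_ge0 sqrtr_ge0.
Qed.

End zones.

(** * Integration over the sphere by slicing circles *)

Section sphere_slices.
Variable R : realType.
Local Notation mu := (@lebesgue_measure R).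

(** A total map, with the north pole as value off the sphere, lets a function on
    the sphere be composed with arbitrary real coordinates, as [zone_swap]
    requires. *)
Definition S2_of (a b c : R) : S2 R :=
  insubd (S2_pt (north_pole_subproof R) : set_type (@unit_sphere R)) (vec3 a b c).

Lemma S2_ofE (a b c : R) (abc : (a ^+ 2 + b ^+ 2 + c ^+ 2 = 1)%R) :
  S2_of a b c = S2_pt abc.
Proof.
by apply: val_inj; rewrite /S2_of val_insubd/= vec3_unit_sphere.
Qed.

Lemma measurable_S2_of d (T : measurableType d) (a b c : T -> R) :
  measurable_fun setT a -> measurable_fun setT b -> measurable_fun setT c ->
  measurable_fun setT (fun t => S2_of (a t) (b t) (c t)).
Proof.
move=> ma mb mc; apply: measurable_fun_S2 => i.
have mv : measurable_fun setT (fun t => vec3 (a t) (b t) (c t) 0%R i).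
  by case: i => -[|[|[|//]]] i; under eq_fun do rewrite mxE.
rewrite (_ : _ \o _ = fun t => if (a t ^+ 2 + b t ^+ 2 + c t ^+ 2)%R == 1%R
    then vec3 (a t) (b t) (c t) 0%R i else crd i (S2_pt (north_pole_subproof R))).
  apply: measurable_fun_if => //.
  - apply: (measurable_fun_eqr (f := fun t => (a t ^+ 2 + b t ^+ 2 + c t ^+ 2)%R)) => //.
    by apply: measurable_funD; [apply: measurable_funD|]; exact: measurable_funX.
  - exact: measurable_funTS.
apply/funext => t /=; rewrite /crd /S2_of val_insubd.
rewrite (_ : (vec3 _ _ _ \in _) = ((a t ^+ 2 + b t ^+ 2 + c t ^+ 2)%R == 1%R)).
  by case: ifP.
apply/idP/eqP => [|/vec3_unit_sphere//].
by rewrite inE /unit_sphere/= !big_ord_recl big_ord0 !mxE/= addr0 addrA.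
Qed.

Lemma ge0_integral_Ibd (K : R -> \bar R) :
  measurable_fun setT K -> (forall t, 0 <= K t) ->
  \int[Ibd_measure R]_t K (Ival t) = \int[mu]_(t in `[(-1)%R, 1%R]) K t.
Proof.
move=> mK K0.
have mD : measurable (`[(-1)%R, 1%R]%classic : set (measurableTypeR R)).
  exact: measurable_itv.
have mI : measurable_fun setT (@Ival R : Ibd R -> measurableTypeR R).
  exact: measurable_Ival.
rewrite -(ge0_integral_mrestr mu mD mK K0).
rewrite -[LHS](@ge0_integral_pushforward _ _ _ _ R _ mI (Ibd_measure R) setT K)//.
apply: eq_measure_integral => A mA _; congr (mu _).
apply/seteqP; split => [_ [t At <-]|t [At t1]].
  by split => //; exact: set_valP.
by exists (exist _ t (mem_set t1)).
Qed.

Lemma measurable_sphr (theta : R) : measurable_fun setT (fun phi => sph phi theta).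
Proof.
have mp : measurable_fun [set: R] (fun phi => (phi, theta)).
  by apply: measurable_fun_pair.
exact: (measurableT_comp (@measurable_sph R) mp).
Qed.

(** This is the definition of the surface measure, passed from sets to
    functions. *)
Lemma ge0_integral_S2 (g : S2 R -> \bar R) :
  measurable_fun setT g -> (forall x, 0 <= g x) ->
  \int[S2_measure R]_x g x =
  \int[mu]_(theta in `[0%R, pi])
    ((\int[mu]_(phi in `[0%R, (2 * pi)%R]) g (sph phi theta)) * (sin theta)%:E).
Proof.
move=> mg g0.
pose w (p : R * R) : R := `|sin p.2|%R.
have mw : measurable_fun setT w.
  apply: measurableT_comp => //; exact: measurableT_comp (@measurable_sin R) _.
have mgw : measurable_fun setT (fun p => g (sph p.1 p.2) * (w p)%:E).
  apply: emeasurable_funM; last exact/measurable_EFinP.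
  exact: (measurableT_comp mg (@measurable_sph R)).
rewrite (@ge0_integral_weighted _ _ _ _ R (mu \x mu) (S2_measure R) (@sph_dom R)
    (fun p => sph p.1 p.2) w)//; last 4 first.
- by apply: measurableX; exact: measurable_itv.
- exact: measurable_sph.
- by move=> p _; exact: normr_ge0.
- by move=> A mA; apply: eq_integral => p _; rewrite area_element_sph.
have gw0 p : 0 <= g (sph p.1 p.2) * (w p)%:E by rewrite mule_ge0// lee_fin normr_ge0.
transitivity (\int[mu]_(phi in `[0%R, (2 * pi)%R]) \int[mu]_(theta in `[0%R, pi])
    (g (sph phi theta) * (w (phi, theta))%:E)).
  exact: (@tonelli_rectangle _ _ _ _ _ mu mu _ _ _ _ _ mgw gw0).
transitivity (\int[mu]_(theta in `[0%R, pi]) \int[mu]_(phi in `[0%R, (2 * pi)%R])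
    (g (sph phi theta) * (w (phi, theta))%:E)).
  exact: (@tonelli_rectangle_swap _ _ _ _ _ mu mu _ _ _ _ _ mgw gw0).
apply: eq_integral => theta; rewrite inE/= in_itv/= => thetapi.
rewrite /w/= ge0_integralZr//.
- by rewrite /w/= ger0_norm// sin_ge0_pi.
- apply: measurable_funTS; exact: measurableT_comp mg (measurable_sphr theta).
Qed.

(** With [q] the function [g] rotated by [psi] about [e_3], the left-hand side
    is the integral of [q] with polar axis [e_3], up to a translation of the
    longitude.  [zone_swap] moves the axis to [e_1], where the circles are those
    of the right-hand side up to the change of angle
    [alpha = pi / 2 - phi]. *)
Lemma ge0_integral_slices (psi : torus R) (g : S2 R -> \bar R) :
  measurable_fun setT g -> (forall x, 0 <= g x) ->
  \int[S2_measure R]_x g x =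
  \int[Ibd_measure R]_t
    \int[mu]_(alpha in `[0%R, (2 * pi)%R]) g (circle psi t alpha).
Proof.
move=> mg g0.
set C := torus_cos psi; set S := torus_sin psi.
(* The representative of [psi] may be any real, while a translation over a period
   needs an angle between 0 and 2 pi. *)
have [a a2 [Ca Sa]] := @polar_angle R C S (cos2Dsin2 _).
pose q (x y z : R) := g (S2_of (x * C - y * S) (x * S + y * C) z).
have q0 x y z : 0 <= q x y z by exact: g0.
have mq : measurable_fun setT (fun p : R * R * R => q p.1.1 p.1.2 p.2).
  have m1 : measurable_fun setT (fun p : R * R * R => p.1.1).
    exact: measurableT_comp measurable_fst measurable_fst.
  have m2 : measurable_fun setT (fun p : R * R * R => p.1.2).
    exact: measurableT_comp measurable_snd measurable_fst.
  apply: (measurableT_comp mg); apply: measurable_S2_of => //.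
  - by apply: measurable_funB; apply: measurable_funM.
  - by apply: measurable_funD; apply: measurable_funM.
have mqc := measurable_fun3 mq.
pose rad (z : R) := Num.sqrt (1 - z ^+ 2).
have mrad : measurable_fun setT rad.
  by apply: (measurableT_comp (@measurable_sqrt R)); exact: measurable_Bsqr.
have mc := @measurable_cos R; have ms := @measurable_sin R.
have mint (b c : R -> R) (q' : R -> R -> R -> \bar R) :
    measurable_fun setT b -> measurable_fun setT c ->
    measurable_fun setT (fun p : R * R * R => q' p.1.1 p.1.2 p.2) ->
    (forall x y z, 0 <= q' x y z) ->
    measurable_fun setT (fun z => \int[mu]_(phi in `[0%R, (2 * pi)%R])
      q' (rad z * b phi)%R (rad z * c phi)%R z).
  move=> mb mc' mq' q'0.
  apply: (@measurable_integral_in _ _ (measurableTypeR R) (measurableTypeR R) R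
    mu _ (fun p : R * R => q' (rad p.1 * b p.2)%R (rad p.1 * c p.2)%R p.1)) => //.
  have mr1 : measurable_fun setT (fun p : R * R => rad p.1).
    exact: measurableT_comp mrad measurable_fst.
  apply: (measurable_fun3 mq') => //; apply: measurable_funM => //.
  - exact: measurableT_comp mb measurable_snd.
  - exact: measurableT_comp mc' measurable_snd.
transitivity (\int[mu]_(z in `[(-1)%R, 1%R]) \int[mu]_(phi in `[0%R, (2 * pi)%R])
    q (rad z * cos phi)%R (rad z * sin phi)%R z).
  rewrite ge0_integral_S2// ge0_integral_substitution_cos//; last 2 first.
  - exact: mint.
  - by move=> z; exact: integral_ge0.
  apply: eq_integral => theta; rewrite inE/= in_itv/= => thetapi.
  rewrite !mul1r; congr (_ * _).
  rewrite -(@ge0_integral_period_shift R (fun phi => g (sph phi theta)) _ _ _ a)//.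
  - apply: eq_integral => phi _; congr g.
    have -> : rad (cos theta) = sin theta.
      by rewrite /rad -sin2cos2 sqrtr_sqr ger0_norm// sin_ge0_pi.
    rewrite /sph -S2_ofE -Ca -Sa cosD sinD.
    by congr S2_of; ring.
  - exact: measurableT_comp mg (measurable_sphr theta).
  - move=> phi; congr g; apply: val_inj => /=.
    by rewrite mulr_natl cosD2pi sinD2pi.
rewrite (zone_swap mq q0).
transitivity (\int[mu]_(t in `[(-1)%R, 1%R]) \int[mu]_(phi in `[0%R, (2 * pi)%R])
    q t (rad t * cos phi)%R (rad t * sin phi)%R).
  apply: eq_integral => t _.
  pose k phi := q t (rad t * cos phi)%R (rad t * sin phi)%R.
  have mk : measurable_fun setT k.
    by apply: mqc => //; apply: measurable_funM.
  have kp phi : k (phi + 2 * pi)%R = k phi.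
    by rewrite /k mulr_natl cosD2pi sinD2pi.
  have k0 phi : 0 <= k phi by exact: q0.
  have pi0 := pi_ge0 R.
  rewrite -[RHS](@ge0_integral_period_shift R k mk k0 kp (pi / 2))//; last first.
    by apply/andP; split; lra.
  rewrite -[RHS](@ge0_integral_period_opp R (fun x => k (x + pi / 2)%R))//.
  - by apply: eq_integral => x _; rewrite /k cosDpihalf sinDpihalf sinN cosN opprK.
  - by apply: measurableT_comp => //; exact: measurable_funD.
  - by move=> x; rewrite addrAC kp.
rewrite -ge0_integral_Ibd.
- apply: eq_integral => t _; apply: eq_integral => alpha _.
  by congr g; rewrite /circle -S2_ofE.
- apply: (mint cos sin (fun x y z => q z x y)) => //.
  apply: (mqc _ _ snd (fst \o fst) (snd \o fst)) => //.
    exact: measurableT_comp measurable_fst measurable_fst.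
  exact: measurableT_comp measurable_snd measurable_fst.
- by move=> t; exact: integral_ge0.
Qed.

End sphere_slices.

(** * The transforms of functions as integrals over circles *)

(** When [a - b] is indeterminate it takes a conventional infinite value, which
    a positive factor preserves. *)
Lemma gt0_muleBr (R : realDomainType) (c : R) (a b : \bar R) : (0 < c)%R ->
  c%:E * (a - b) = c%:E * a - c%:E * b.
Proof.
move=> c0; case: a b => [a| |] [b| |];
  rewrite ?gt0_muley ?gt0_muleNy ?lte_fin//= ?gt0_muley ?gt0_muleNy ?lte_fin//.
by rewrite -!EFinM -!EFinB mulrBr.
Qed.

(** The integral may be infinite or indeterminate: an integrable function on the
    sphere can fail to be integrable on a given circle. *)
Lemma gt0_integralZl d (T : measurableType d) (R : realType)
    (m : {measure set T -> \bar R}) (D : set T) (c : R) (h : T -> \bar R) :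
  measurable D -> measurable_fun D h -> (0 < c)%R ->
  \int[m]_(x in D) (c%:E * h x) = c%:E * \int[m]_(x in D) h x.
Proof.
move=> mD mh c0; rewrite integralE ge0_funeposM ?ge0_funenegM ?(ltW c0)//.
rewrite !ge0_integralZl_EFin ?(ltW c0)//; last 2 first.
- exact: measurable_funeneg.
- exact: measurable_funepos.
by rewrite -gt0_muleBr// -integralE.
Qed.

Lemma gt0_integral_mscale d (T : measurableType d) (R : realType)
    (m : {measure set T -> \bar R}) (k : {nonneg R}) (D : set T) (h : T -> \bar R) :
  measurable D -> measurable_fun D h -> (0 < k%:num)%R ->
  \int[mscale k m]_(x in D) h x = k%:num%:E * \int[m]_(x in D) h x.
Proof.
move=> mD mh k0; rewrite [LHS]integralE [X in _ * X]integralE gt0_muleBr//.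
by rewrite !ge0_integral_mscale//; [exact: measurable_funeneg|exact: measurable_funepos].
Qed.

Section slice_integrals.
Variable R : realType.
Local Notation mu := (@lebesgue_measure R).

(** The integral is taken in the angle and not in the arc length. *)
Definition circle_integral (f : S2 R -> R) (p : torus R * Ibd R) : \bar R :=
  \int[mu]_(alpha in `[0%R, (2 * pi)%R]) (f (circle p.1 p.2 alpha))%:E.

Lemma measurable_circle :
  measurable_fun setT (fun p : torus R * Ibd R * R => circle p.1.1 p.1.2 p.2).
Proof.
have mt : measurable_fun setT (fun p : torus R * Ibd R * R => Ival p.1.2).
  apply: measurableT_comp (@measurable_Ival R) _.
  exact: measurableT_comp measurable_snd measurable_fst.
have mC : measurable_fun setT (fun p : torus R * Ibd R * R => torus_cos p.1.1).
  apply: measurableT_comp (@measurable_torus_cos R) _.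
  exact: measurableT_comp measurable_fst measurable_fst.
have mS : measurable_fun setT (fun p : torus R * Ibd R * R => torus_sin p.1.1).
  apply: measurableT_comp (@measurable_torus_sin R) _.
  exact: measurableT_comp measurable_fst measurable_fst.
have mc : measurable_fun setT (fun p : torus R * Ibd R * R => cos p.2).
  exact: measurableT_comp (@measurable_cos R) measurable_snd.
have ms : measurable_fun setT (fun p : torus R * Ibd R * R => sin p.2).
  exact: measurableT_comp (@measurable_sin R) measurable_snd.
have mr : measurable_fun setT
    (fun p : torus R * Ibd R * R => Num.sqrt (1 - Ival p.1.2 ^+ 2))%R.
  exact: measurableT_comp (@measurable_sqrt R) (measurableT_comp (measurable_Bsqr 1) mt).
rewrite (_ : (fun _ => _) = (fun p : torus R * Ibd R * R =>
  let r := Num.sqrt (1 - Ival p.1.2 ^+ 2) in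
  S2_of (Ival p.1.2 * torus_cos p.1.1 - r * cos p.2 * torus_sin p.1.1)
        (Ival p.1.2 * torus_sin p.1.1 + r * cos p.2 * torus_cos p.1.1)
        (r * sin p.2))); last first.
  by apply/funext => p /=; rewrite /circle -S2_ofE.
apply: measurable_S2_of.
- by apply: measurable_funB; apply: measurable_funM => //; apply: measurable_funM.
- by apply: measurable_funD; apply: measurable_funM => //; apply: measurable_funM.
- exact: measurable_funM.
Qed.

Lemma measurable_circler (psi : torus R) (t : Ibd R) :
  measurable_fun setT (circle psi t).
Proof.
have mp : measurable_fun [set: R] (fun alpha => (psi, t, alpha)).
  by apply: measurable_fun_pair.
exact: (measurableT_comp measurable_circle mp).
Qed.

Lemma measurable_circle_integral (f : S2 R -> R) :
  measurable_fun setT f -> measurable_fun setT (circle_integral f).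
Proof.
move=> mf.
have mfc : measurable_fun setT
    (fun p : torus R * Ibd R * R => (f (circle p.1.1 p.1.2 p.2))%:E).
  by apply/measurable_EFinP; exact: (measurableT_comp mf measurable_circle).
pose F (p : torus R * Ibd R * R) := (f (circle p.1.1 p.1.2 p.2))%:E.
rewrite (_ : circle_integral f = (fun p =>
    \int[mu]_(alpha in `[0%R, (2 * pi)%R]) F^\+ (p, alpha) -
    \int[mu]_(alpha in `[0%R, (2 * pi)%R]) F^\- (p, alpha))); last first.
  by apply/funext => p; rewrite /circle_integral integralE;
    congr (_ - _); apply: eq_integral => alpha _; rewrite ?funeposE ?funenegE.
apply: emeasurable_funB; apply: measurable_integral_in => //.
- exact: measurable_funepos.
- exact: measurable_funeneg.
Qed.

(** A circle of radius [sqrt (1 - t^2)], parametrized by its angle. *)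
Lemma circle_speed (psi : torus R) (t : Ibd R) (alpha : R) :
  let v := vderive1 (fun r => \val (circle psi t r)) alpha in
  Num.sqrt (dotp v v) = Num.sqrt (1 - Ival t ^+ 2).
Proof.
set s := Num.sqrt (1 - Ival t ^+ 2) => v.
have -> : v = vec3 (s * sin alpha * torus_sin psi)
    (- (s * sin alpha * torus_cos psi)) (s * cos alpha).
  apply/rowP => i; rewrite !mxE derive1E.
  case: i => -[|[|[|//]]] i /=.
  - rewrite (_ : (fun _ => _) = (fun r => Ival t * torus_cos psi -
        s * cos r * torus_sin psi)%R); last first.
      by apply/funext => r; rewrite mxE.
    by rewrite derive_val /GRing.scale/=; ring.
  - rewrite (_ : (fun _ => _) = (fun r => Ival t * torus_sin psi +
        s * cos r * torus_cos psi)%R); last first.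
      by apply/funext => r; rewrite mxE.
    by rewrite derive_val /GRing.scale/=; ring.
  - rewrite (_ : (fun _ => _) = (fun r => s * sin r)%R); last first.
      by apply/funext => r; rewrite mxE.
    by rewrite derive_val /GRing.scale/=; ring.
rewrite /dotp !big_ord_recl big_ord0 !mxE/=.
have h1 := cos2Dsin2 alpha.
have h2 : (torus_cos psi ^+ 2 + torus_sin psi ^+ 2 = 1)%R by exact: cos2Dsin2.
rewrite [X in Num.sqrt X](_ : _ = s ^+ 2)%R;
  first by rewrite sqrtr_sqr ger0_norm ?sqrtr_ge0.
transitivity (s ^+ 2 * (sin alpha ^+ 2 * (torus_cos psi ^+ 2 + torus_sin psi ^+ 2) +
  cos alpha ^+ 2))%R; first by ring.
by rewrite h2 mulr1 addrC h1 mulr1.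
Qed.

(** The speed of the parametrization cancels the weight [sqrt (1 - t^2)]. *)
Lemma vertical_slice_transformE (f : S2 R -> R) (p : torus R * Ibd R) :
  measurable_fun setT f ->
  vertical_slice_transform f p = if (-1 < Ival p.2 < 1)%R
    then (2 * pi)^-1%:E * circle_integral f p else (f (circle p.1 p.2 0))%:E.
Proof.
move=> mf; rewrite /vertical_slice_transform; case: ifPn => // t1.
have r0 : (0 < Num.sqrt (1 - Ival p.2 ^+ 2))%R.
  by rewrite sqrtr_gt0; move: t1 => /andP[]; nra.
rewrite /arc_integral /circle_integral.
under eq_integral do rewrite circle_speed mulrC EFinM.
rewrite gt0_integralZl//; last first.
  apply/measurable_EFinP; apply: measurable_funTS.
  exact: measurableT_comp mf (measurable_circler _ _).
by rewrite muleA -EFinM invfM -mulrA mulVf ?mulr1// gt_eqF.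
Qed.

Lemma measurable_vertical_slice_transform (f : S2 R -> R) :
  measurable_fun setT f -> measurable_fun setT (vertical_slice_transform f).
Proof.
move=> mf.
rewrite (_ : vertical_slice_transform f = fun p => if (-1 < Ival p.2 < 1)%R
    then (2 * pi)^-1%:E * circle_integral f p else (f (circle p.1 p.2 0))%:E); last first.
  by apply/funext => p; exact: vertical_slice_transformE.
have mt : measurable_fun setT (fun p : torus R * Ibd R => Ival p.2).
  exact: measurableT_comp (@measurable_Ival R) measurable_snd.
apply: measurable_fun_if => //.
- by apply: measurable_and; exact: measurable_fun_ltr.
- apply: measurable_funTS; apply: measurable_funeM.
  exact: measurable_circle_integral.
- apply: measurable_funTS; apply/measurable_EFinP; apply: (measurableT_comp mf).
  have mp : measurable_fun setT (fun p : torus R * Ibd R => (p, 0%R : R)).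
    by apply: measurable_fun_pair.
  exact: (measurableT_comp measurable_circle mp).
Qed.

End slice_integrals.

(** * The slice transform for a fixed angle *)

Section slice_transforms.
Variable R : realType.
Local Notation mu := (@lebesgue_measure R).

Lemma slice_circle (psi : torus R) (t : Ibd R) (alpha : R) :
  (0 <= alpha <= 2 * pi)%R -> slice psi (circle psi t alpha) = t.
Proof.
move=> alpha2.
suff : (slice psi @^-1` [set t]) (circle psi t alpha) by [].
by rewrite -circle_image; exists alpha => //=; rewrite in_itv.
Qed.

Lemma measurable_slice_preimage (psi : torus R) (A : set (Ibd R)) :
  measurable A -> measurable (slice psi @^-1` A).
Proof.
by move=> mA; rewrite -[X in measurable X]setTI; exact: measurable_slice.
Qed.

(** On the circle over [t] the indicator of [slice psi @^-1` A] is constant, with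
    the value at [t] of the indicator of [A]. *)
Lemma ge0_integral_slices_in (psi : torus R) (A : set (Ibd R)) (g : S2 R -> \bar R) :
  measurable A -> measurable_fun setT g -> (forall x, 0 <= g x) ->
  \int[S2_measure R]_(x in slice psi @^-1` A) g x =
  \int[Ibd_measure R]_(t in A)
    \int[mu]_(alpha in `[0%R, (2 * pi)%R]) g (circle psi t alpha).
Proof.
move=> mA mg g0.
have mSA := measurable_slice_preimage psi mA.
rewrite integral_mkcond (@ge0_integral_slices _ psi).
- rewrite [RHS]integral_mkcond; apply: eq_integral => t _; rewrite /patch.
  case: ifPn => tA.
    apply: eq_integral => alpha; rewrite inE/= in_itv/= => alpha2.
    rewrite ifT//; apply/mem_set => /=.
    by rewrite slice_circle//; exact: set_mem.
  apply: integral0_eq => alpha; rewrite /= in_itv/= => alpha2.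
  rewrite ifF//; apply/negbTE/negP => /set_mem/=.
  by rewrite slice_circle// => /mem_set tA'; rewrite tA' in tA.
- by apply/(measurable_restrictT _ mSA); exact: measurable_funTS.
- by move=> x; rewrite /patch; case: ifP.
Qed.

Lemma measurable_endpoints :
  measurable [set t : Ibd R | ~~ (-1 < Ival t < 1)%R].
Proof.
rewrite (_ : [set _ | _] = @Ival R @^-1` (~` `](-1)%R, 1%R[%classic)).
  rewrite -[X in measurable X]setTI; apply: measurable_Ival => //.
  by apply: measurableC; exact: measurable_itv.
by apply/seteqP; split => t /=; rewrite in_itv/= => /negP.
Qed.

Lemma Ibd_endpoints_null :
  Ibd_measure R [set t | ~~ (-1 < Ival t < 1)%R] = 0.
Proof.
rewrite /Ibd_measure; apply: countable_lebesgue_measure0.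
apply: (@sub_countable _ _ _ [set (-1)%R; 1%R]); last first.
  by apply: finite_set_countable; exact: finite_set2.
apply: subset_card_le => _ [t /= t1 <-] /=.
have : `[(-1)%R, 1%R]%classic (Ival t) by exact: set_valP.
rewrite /= in_itv/= => /andP[]; move: t1.
rewrite negb_and -!leNgt => /orP[] h1 h2 h3; [left|right]; apply/eqP.
  by rewrite eq_le h1 h2.
by rewrite eq_le h1 h3.
Qed.

Variable f : S2 R -> R.
Hypothesis intf : (S2_measure R).-integrable [set: S2 R] (EFin \o f).

Let mEf : measurable_fun setT (EFin \o f).
Proof. exact: measurable_int intf. Qed.

Lemma measurable_of_integrable : measurable_fun setT f.
Proof. by apply/measurable_EFinP; exact: mEf. Qed.
Let mf := measurable_of_integrable.

Lemma slice_transformE psi t : slice_transform psi f t =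
  (2 * pi)%:E * vertical_slice_transform f (psi, t).
Proof. by []. Qed.

Lemma measurable_slice_transform psi : measurable_fun setT (slice_transform psi f).
Proof.
apply: measurable_funeM; have mp : measurable_fun [set: Ibd R] (pair psi).
  by apply: measurable_fun_pair.
exact: measurableT_comp (measurable_vertical_slice_transform mf) mp.
Qed.

(** The two sides may only differ at the endpoints [t = 1] and [t = -1]. *)
Lemma ae_slice_transform psi :
  ae_eq (Ibd_measure R) setT (slice_transform psi f)
    (fun t => circle_integral f (psi, t)).
Proof.
exists [set t | ~~ (-1 < Ival t < 1)%R]; split.
- exact: measurable_endpoints.
- exact: Ibd_endpoints_null.
- move=> t /=; apply: contra_notN => t1 _.
  rewrite slice_transformE vertical_slice_transformE//= t1 muleA -EFinM.
  by rewrite divff ?mul1e// gt_eqF// mulr_gt0// pi_gt0.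
Qed.

Lemma measurable_circle_integral_slice psi :
  measurable_fun setT (fun t => circle_integral f (psi, t)).
Proof.
have mp : measurable_fun [set: Ibd R] (pair psi) by apply: measurable_fun_pair.
exact: measurableT_comp (measurable_circle_integral mf) mp.
Qed.

Lemma integral_abs_slice_transform psi :
  \int[Ibd_measure R]_t `|slice_transform psi f t| <=
  \int[S2_measure R]_x `|(f x)%:E|.
Proof.
rewrite (ge0_integral_slices psi) => [|//|//]; last exact: measurableT_comp mEf.
rewrite (@ae_eq_integral _ _ _ (Ibd_measure R) setT
  (fun t => `|circle_integral f (psi, t)|))//; last 3 first.
- apply: measurableT_comp => //; exact: measurable_slice_transform.
- apply: measurableT_comp => //; exact: measurable_circle_integral_slice.
- exact: ae_eq_abse (ae_slice_transform psi).
apply: ge0_le_integral => //.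
- apply: measurableT_comp => //; exact: measurable_circle_integral_slice.
- have mp : measurable_fun [set: Ibd R] (pair psi) by apply: measurable_fun_pair.
  have mnf : measurable_fun setT (fun x => `|f x|%R) by exact: measurableT_comp.
  exact: measurableT_comp (measurable_circle_integral mnf) mp.
- move=> t _; apply: le_abse_integral => //.
  apply/measurable_EFinP; apply: measurable_funTS.
  exact: measurableT_comp mf (measurable_circler _ _).
Qed.

Lemma integrable_slice_transform psi :
  (Ibd_measure R).-integrable setT (slice_transform psi f).
Proof.
apply/integrableP; split; first exact: measurable_slice_transform.
apply: le_lt_trans (integral_abs_slice_transform psi) _.
by case/integrableP : intf.
Qed.

(** The positive and negative parts of [f] are treated separately; both have
    integrable circle integrals, so that the difference may be integrated term
    by term. *)
Lemma integral_slice_transform psi (A : set (Ibd R)) : measurable A ->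
  \int[S2_measure R]_(x in slice psi @^-1` A) (f x)%:E =
  \int[Ibd_measure R]_(t in A) slice_transform psi f t.
Proof.
move=> mA.
transitivity (\int[Ibd_measure R]_(t in A) circle_integral f (psi, t)); last first.
  apply: ae_eq_integral => //.
  - by apply: measurable_funTS; exact: measurable_circle_integral_slice.
  - by apply: measurable_funTS; exact: measurable_slice_transform.
  - by apply: ae_eq_sym; exact: (ae_eq_subset (@subsetT _ A) (ae_slice_transform psi)).
have mp : measurable_fun [set: Ibd R] (pair psi) by apply: measurable_fun_pair.
have mfp := measurable_funepos mEf; have mfn := measurable_funeneg mEf.
have mslice (g : S2 R -> \bar R) : measurable_fun setT g -> (forall x, 0 <= g x) ->
    measurable_fun setT
      (fun t => \int[mu]_(alpha in `[0%R, (2 * pi)%R]) g (circle psi t alpha)).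
  move=> mg g0; pose G (p : torus R * Ibd R * R) := g (circle p.1.1 p.1.2 p.2).
  have mG : measurable_fun setT G by exact: (measurableT_comp mg (@measurable_circle R)).
  have G0 p : 0 <= G p by exact: g0.
  have mint := measurable_integral_in mu (measurable_itv `[0%R, (2 * pi)%R]) mG G0.
  exact: measurableT_comp mint mp.
have intslice (g : S2 R -> \bar R) : (S2_measure R).-integrable setT g ->
    (forall x, 0 <= g x) -> (Ibd_measure R).-integrable A
      (fun t => \int[mu]_(alpha in `[0%R, (2 * pi)%R]) g (circle psi t alpha)).
  move=> ig g0; have mg := measurable_int _ ig.
  apply: (integrableS measurableT) => //; apply/integrableP; split; first exact: mslice.
  under eq_integral do rewrite gee0_abs ?integral_ge0//.
  rewrite -ge0_integral_slices//.
  case/integrableP : ig => _.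
  by under eq_integral do rewrite gee0_abs//.
rewrite [LHS]integralE ge0_integral_slices_in// ge0_integral_slices_in//.
rewrite -integralB//; last 2 first.
- by apply: intslice => //; exact: integrable_funepos.
- by apply: intslice => //; exact: integrable_funeneg.
apply: eq_integral => t _; rewrite /circle_integral [RHS]integralE.
by congr (_ - _); apply: eq_integral => alpha _; rewrite ?funeposE ?funenegE.
Qed.

End slice_transforms.

(** * The vertical slice transform *)

Lemma charge_with_density_dominated d (T : measurableType d) (R : realType)
    (m : {measure set T -> \bar R}) (h : T -> \bar R) (nu : {charge set T -> \bar R}) :
  measurable_fun setT h ->
  (forall A, measurable A -> nu A = \int[m]_(x in A) h x) -> nu `<< m.
Proof.
move=> mh nuE; apply/null_content_dominatesP => A mA mA0.
by rewrite nuE// null_set_integral//; exact: measurable_funTS.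
Qed.

Section vertical_slice.
Variables (R : realType) (f : S2 R -> R).
Hypothesis intf : (S2_measure R).-integrable [set: S2 R] (EFin \o f).
Local Notation twopi := (2 * pi : R)%R.

Let twopi_gt0 : (0 < twopi)%R. Proof. by rewrite mulr_gt0// pi_gt0. Qed.

Let mf : measurable_fun setT f. Proof. exact: measurable_of_integrable intf. Qed.

Lemma vertical_slice_transform_scale (p : torus R * Ibd R) :
  vertical_slice_transform f p = twopi^-1%:E * slice_transform p.1 f p.2.
Proof.
by rewrite slice_transformE muleA -EFinM mulVf ?mul1e ?gt_eqF.
Qed.

(** The norm of [V_psi f] in [L^1] is at most the norm of [f], uniformly in
    [psi], and the torus has finite mass. *)
Lemma integrable_vertical_slice_transform :
  (torus_measure R \x Ibd_measure R).-integrable setT (vertical_slice_transform f).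
Proof.
have mV := measurable_vertical_slice_transform mf.
apply/integrable12ltyP => //.
set M := \int[S2_measure R]_x `|(f x)%:E|.
have Mfin : M < +oo by case/integrableP : intf.
have M0 : 0 <= M by exact: integral_ge0.
have mVa : measurable_fun setT (abse \o vertical_slice_transform f).
  exact: measurableT_comp.
apply: (@le_lt_trans _ _ (\int[torus_measure R]_psi (twopi^-1%:E * M))).
  apply: ge0_le_integral => //.
  - by move=> psi _; exact: integral_ge0.
  - apply: (measurable_integral_in (Ibd_measure R) measurableT mVa) => p.
    exact: abse_ge0.
  - move=> psi _; under eq_integral do rewrite vertical_slice_transform_scale abseM.
    rewrite ge0_integralZl//; last first.
      by apply: measurableT_comp => //; exact: (measurable_slice_transform intf).
    rewrite gee0_abs ?lee_fin ?invr_ge0 ?(ltW twopi_gt0)//.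
    rewrite lee_pmul2l ?lte_fin ?invr_gt0//.
    exact: integral_abs_slice_transform.
rewrite integral_cst// ltey_eq !fin_numM//; first by rewrite ge0_fin_numE.
by rewrite fin_num_measure.
Qed.

(** Both sides are integrals over [psi]: the left-hand side by the definition of
    the product of the uniform law with a charge, the right-hand side by Fubini.
    For each [psi] the integrands agree by [integral_slice_transform], applied
    to the section of [A] at [psi]. *)
Lemma vertical_slice_transform_measE (A : set (torus R * Ibd R)%type) :
  measurable A ->
  vertical_slice_transform_meas (induced_charge intf) A =
  \int[torus_measure R \x Ibd_measure R]_(p in A) vertical_slice_transform f p.
Proof.
move=> mA; have iV := integrable_vertical_slice_transform.
have mxA psi : measurable (xsection A psi) by exact: measurable_xsection.
have iVA : (torus_measure R \x Ibd_measure R).-integrable setT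
    (vertical_slice_transform f \_ A).
  apply/(integrable_mkcond _ mA).
  exact: (integrableS measurableT mA (@subsetT _ A) iV).
have sectE psi : \int[Ibd_measure R]_t (vertical_slice_transform f \_ A) (psi, t) =
    twopi^-1%:E * \int[S2_measure R]_(x in slice psi @^-1` xsection A psi) (f x)%:E.
  rewrite (integral_slice_transform intf)//.
  rewrite -gt0_integralZl ?invr_gt0//; last first.
    by apply: measurable_funTS; exact: (measurable_slice_transform intf).
  rewrite [RHS]integral_mkcond; apply: eq_integral => t _.
  rewrite /patch mem_xsection; case: ifP => // _.
  by rewrite vertical_slice_transform_scale.
rewrite [RHS]integral_mkcond -integral12_prod_meas1// /fubini_F.
under [RHS]eq_integral do rewrite sectE.
transitivity (\int[torus_unif R]_psi
    \int[S2_measure R]_(x in slice psi @^-1` xsection A psi) (f x)%:E).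
  (* The section at [psi] of the preimage of [A] by [T_V] is, by definition, the
     preimage by [slice psi] of the section of [A]. *)
  by [].
have muniff : measurable_fun setT (fun psi : torus R =>
    \int[S2_measure R]_(x in slice psi @^-1` xsection A psi) (f x)%:E).
  rewrite (_ : (fun _ => _) = (fun psi => twopi%:E *
      fubini_F (Ibd_measure R) (vertical_slice_transform f \_ A) psi)).
    by apply: measurable_funeM; exact: measurable_fubini_F iVA.
  apply/funext => psi; rewrite /fubini_F sectE muleA -EFinM divff ?mul1e//.
  by rewrite gt_eqF.
rewrite /torus_unif gt0_integral_mscale//= ?invr_gt0//.
by rewrite gt0_integralZl ?invr_gt0.
Qed.

End vertical_slice.

Unset Implicit Arguments.

Theorem proposition3p6 (R : realType) (f : S2 R -> R)
    (intf : (S2_measure R).-integrable [set: S2 R] (EFin \o f)) :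
  (exists intVf : (torus_measure R \x Ibd_measure R).-integrable
                    [set: torus R * Ibd R] (vertical_slice_transform f),
     (forall A : set (torus R * Ibd R)%type, measurable A ->
        vertical_slice_transform_meas (induced_charge intf) A =
        induced_charge intVf A) /\
     vertical_slice_transform_meas (induced_charge intf)
       `<< torus_measure R \x Ibd_measure R) /\
  (forall psi : torus R,
     exists intVf : (Ibd_measure R).-integrable
                      [set: Ibd R] (slice_transform psi f),
       (forall A : set (Ibd R), measurable A ->
          slice_transform_meas psi (induced_charge intf) A =
          induced_charge intVf A) /\
       slice_transform_meas psi (induced_charge intf) `<< Ibd_measure R).
Proof.
split.
  exists (integrable_vertical_slice_transform intf); split.
    by move=> A mA; exact: vertical_slice_transform_measE.
  apply: (@charge_with_density_dominated _ _ _ _ (vertical_slice_transform f)).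
    exact: measurable_vertical_slice_transform (measurable_of_integrable intf).
  by move=> A mA; exact: vertical_slice_transform_measE.
move=> psi; exists (integrable_slice_transform intf psi); split.
  by move=> A mA; exact: (integral_slice_transform intf).
apply: (@charge_with_density_dominated _ _ _ _ (slice_transform psi f)).
  exact: measurable_slice_transform intf psi.
by move=> A mA; exact: (integral_slice_transform intf).
Qed.
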